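(* There are finitely generated subgroups $H_0$ and $H_1$ of Thompson's group $F$, both elementary amenable of EA-class $\omega+2$, such that $H_0$ does not embed into $H_1$ and $H_1$ does not embed into $H_0$.
   Context: Thompson's group $F$ is the group of piecewise linear orientation-preserving homeomorphisms of $[0,1]$ with finitely many breakpoints, all at dyadic rationals, and slopes integral powers of $2$. Elementary amenable groups: the smallest class $EG$ containing finite and abelian groups, closed under extensions and directed unions; $EG_0$ = finite and abelian groups, $EG_{\alpha+1}$ = groups obtained from members of $EG_\alpha$ by one extension or one directed union, $EG_\alpha=\bigcup_{\beta<\alpha}EG_\beta$ for limit $\alpha$; the EA-class of $G$ is the least $\alpha$ with $G\in EG_\alpha$. ''Embeds'' means there is an injective group homomorphism. *)

(* Defs.v *)
From Stdlib Require Import Reals List ZArith ProofIrrelevance.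
Open Scope R_scope.

Record group := Group {
  gcar :> Type;
  gmul : gcar -> gcar -> gcar;
  gone : gcar;
  gassoc : forall x y z, gmul x (gmul y z) = gmul (gmul x y) z;
  gone_l : forall x, gmul gone x = x;
  gone_r : forall x, gmul x gone = x;
  ginv_ex : forall x, exists y, gmul x y = gone /\ gmul y x = gone
}.
Arguments gmul {g}.
Arguments gone {g}.

Definition is_hom (G H : group) (f : G -> H) : Prop :=
  forall x y, f (gmul x y) = gmul (f x) (f y).

Definition injective {A B : Type} (f : A -> B) : Prop :=
  forall x y, f x = f y -> x = y.
Definition surjective {A B : Type} (f : A -> B) : Prop :=
  forall y, exists x, f x = y.

Definition embeds (G H : group) : Prop :=
  exists f : G -> H, is_hom G H f /\ injective f.

Inductive in_gen (G : group) (l : list G) : G -> Prop :=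
| in_gen_one : in_gen G l gone
| in_gen_gen : forall x, In x l -> in_gen G l x
| in_gen_inv : forall x y, in_gen G l x -> gmul x y = gone -> in_gen G l y
| in_gen_mul : forall x y, in_gen G l x -> in_gen G l y -> in_gen G l (gmul x y).

Definition finitely_generated (G : group) : Prop :=
  exists l : list G, forall x, in_gen G l x.

Definition is_finite_group (G : group) : Prop :=
  exists l : list G, forall x, In x l.
Definition is_abelian (G : group) : Prop :=
  forall x y : G, gmul x y = gmul y x.

Definition EG0 (G : group) : Prop := is_finite_group G \/ is_abelian G.

Definition is_extension (P : group -> Prop) (G : group) : Prop :=
  exists (N Q : group) (i : N -> G) (p : G -> Q),
    P N /\ P Q /\ is_hom N G i /\ injective i /\ is_hom G Q p /\ surjective p /\
    (forall g : G, p g = gone <-> exists n, i n = g).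

Definition is_directed_union (P : group -> Prop) (G : group) : Prop :=
  exists (I : Type) (H : I -> group) (j : forall i, H i -> G),
    (forall i, P (H i)) /\
    (forall i, is_hom (H i) G (j i) /\ injective (j i)) /\
    (forall i k, exists l,
        (forall x, exists y, j l y = j i x) /\ (forall x, exists y, j l y = j k x)) /\
    (forall g : G, exists i x, j i x = g).

Definition EGstep (P : group -> Prop) (G : group) : Prop :=
  is_extension P G \/ is_directed_union P G.

Fixpoint EGfin (n : nat) : group -> Prop :=
  match n with
  | O => EG0
  | S m => EGstep (EGfin m)
  end.

Fixpoint EGomega (n : nat) : group -> Prop :=
  match n with
  | O => fun G => exists m, EGfin m G
  | S m => EGstep (EGomega m)
  end.

(* Ordinals below omega*2: Fin n = n, OmegaPlus n = omega + n. *)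
Inductive ea_index := Fin (n : nat) | OmegaPlus (n : nat).

Definition idx_lt (a b : ea_index) : Prop :=
  match a, b with
  | Fin m, Fin n => (m < n)%nat
  | Fin _, OmegaPlus _ => True
  | OmegaPlus _, Fin _ => False
  | OmegaPlus m, OmegaPlus n => (m < n)%nat
  end.

Definition EG (a : ea_index) : group -> Prop :=
  match a with
  | Fin n => EGfin n
  | OmegaPlus n => EGomega n
  end.

Definition EA_class_is (G : group) (a : ea_index) : Prop :=
  EG a G /\ forall b, idx_lt b a -> ~ EG b G.

Definition dyadic (x : R) : Prop :=
  exists (a : Z) (n : nat), x = IZR a / 2 ^ n.

Definition inF (f : R -> R) : Prop :=
  (forall x, (x < 0 \/ 1 < x) -> f x = x) /\
  (forall x, 0 <= x <= 1 -> 0 <= f x <= 1) /\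
  (forall y, 0 <= y <= 1 -> exists x, 0 <= x <= 1 /\ f x = y) /\
  (forall x y, 0 <= x -> x < y -> y <= 1 -> f x < f y) /\
  exists (n : nat) (p : nat -> R),
    p O = 0 /\ p n = 1 /\
    (forall i, (i < n)%nat -> p i < p (S i)) /\
    (forall i, (i <= n)%nat -> dyadic (p i)) /\
    (forall i, (i < n)%nat -> exists (k : Z) (b : R),
        forall x, p i <= x <= p (S i) -> f x = powerRZ 2 k * x + b).

Record subgroupF (S : (R -> R) -> Prop) : Prop := {
  sgF_sub : forall f, S f -> inF f;
  sgF_id : S (fun x => x);
  sgF_comp : forall f g, S f -> S g -> S (fun x => f (g x));
  sgF_inv : forall f, S f -> exists g, S g /\
      (fun x => f (g x)) = (fun x => x) /\ (fun x => g (f x)) = (fun x => x)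
}.

Section SubgroupGroup.
Variables (S : (R -> R) -> Prop) (hS : subgroupF S).

Definition sgF_car := {f : R -> R | S f}.

Lemma sgF_eq (x y : sgF_car) : proj1_sig x = proj1_sig y -> x = y.
Proof.
  destruct x as [f hf], y as [g hg]; simpl; intros e; subst g.
  f_equal; apply proof_irrelevance.
Qed.

Definition sgF_mul (x y : sgF_car) : sgF_car :=
  exist _ (fun t => proj1_sig x (proj1_sig y t))
        (sgF_comp S hS _ _ (proj2_sig x) (proj2_sig y)).

Definition sgF_one : sgF_car := exist _ (fun t => t) (sgF_id S hS).

Lemma sgF_assoc x y z : sgF_mul x (sgF_mul y z) = sgF_mul (sgF_mul x y) z.
Proof. apply sgF_eq; reflexivity. Qed.

Lemma sgF_one_l x : sgF_mul sgF_one x = x.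
Proof. apply sgF_eq; destruct x; reflexivity. Qed.

Lemma sgF_one_r x : sgF_mul x sgF_one = x.
Proof. apply sgF_eq; destruct x; reflexivity. Qed.

Lemma sgF_inv_ex x : exists y, sgF_mul x y = sgF_one /\ sgF_mul y x = sgF_one.
Proof.
  destruct x as [f hf].
  destruct (sgF_inv S hS f hf) as [g [hg [e1 e2]]].
  exists (exist _ g hg); split; apply sgF_eq; simpl; assumption.
Qed.

Definition subgroup_group : group :=
  Group sgF_car sgF_mul sgF_one sgF_assoc sgF_one_l sgF_one_r sgF_inv_ex.

End SubgroupGroup.

(* Main.v *)
Require Import Defs.
From Stdlib Require Import Reals List FinFun ZArith Lia Lra.
From Stdlib Require Import Classical ClassicalEpsilon FunctionalExtensionality ProofIrrelevance.

(** Let [t] be a homeomorphism with fixed points [c1 < c < c2] that expands away from [c] inside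
    [(c1, c2)] and away from [[c1, c2]] outside. Let [g] be a bump with support in [(c1, c2)]
    containing [c], and [f] a bump whose support contains [[c1, c2]], each displacing the
    [t]-preimage of its support. The conjugates of [g] and [f] by powers of [t] have nested
    supports, ordered like Z + Z (index [(false, i)] for [g], [(true, i)] for [f]), and generate an
    iterated wreath product [W] of copies of Z; so [H1 = <g, f, t>] is [W] extended by Z. Put
    [H0 = <g, t, z>] with [z] supported elsewhere; it is [G x Z] for [G = <g, t>], the analogous
    group over the inner chain Z.

    Class: finitely generated subgroups of [W] are solvable, so both groups are extensions of a
    directed union by an abelian group. If a group in [EG_k] has the wreath product of a chain of [m]
    copies of Z as a quotient of a subgroup then [m < 2^(k+1)], by induction on [k]: in an extension,
    either the upper half of the chain survives in the quotient, or commutators with an element of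
    the kernel moving an upper coordinate yield the lower half in the kernel.

    [H0] does not embed into [H1]: conjugation by an element outside [W] shifts the largest
    coordinate moved by an element of [W], so no nontrivial element of [W] commutes with an element
    outside [W], which rules out the central element [z].

    [H1] does not embed into [H0]: consider a homomorphism [p] from [H1] to [G]. The element
    [y = f_1^-1 f_0] moves the inner copy of [W] off itself, and so do its conjugates by powers of
    [g] and [t]. If [p g] or [p t] lies outside [W], these powers contract the index set Z, so some
    conjugate of [p y] acts only on coordinates that are lower than those of any two given elements
    of the image; hence commutators of the inner copy of [W] die. Otherwise [p] maps [<g, t>] into a
    solvable group. Either way the map to [H0] is not injective. *)

Open Scope Z_scope.

(** Stating the step as an equivalence handles positive and negative integers at once; facts about
    integer powers are mostly proved this way. *)
Lemma Z_ind_iff (P : Z -> Prop) : P 0 -> (forall k, P k <-> P (k + 1)) -> forall k, P k.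
Proof.
  intros h0 hs; apply Z.bi_induction; auto; intros x y e; unfold Z.eq in e; subst; tauto.
Qed.

(** * Groups *)

Infix "**" := gmul (at level 40, left associativity).

(** The group record only asserts that inverses exist, so a choice principle turns them into a
    function. *)
Definition inv {G : group} (x : G) : G :=
  proj1_sig (constructive_indefinite_description _ (ginv_ex G x)).

Lemma mul_inv (G : group) (x : G) : x ** inv x = gone.
Proof. apply (proj2_sig (constructive_indefinite_description _ (ginv_ex G x))). Qed.

Lemma inv_mul (G : group) (x : G) : inv x ** x = gone.
Proof. apply (proj2_sig (constructive_indefinite_description _ (ginv_ex G x))). Qed.

Lemma mul_inv_assoc (G : group) (x y : G) : x ** inv y ** y = x.
Proof. rewrite <- gassoc, inv_mul; apply gone_r. Qed.

Lemma mul_assoc_inv (G : group) (x y : G) : x ** y ** inv y = x.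
Proof. rewrite <- gassoc, mul_inv; apply gone_r. Qed.

Lemma mul_cancel_l (G : group) (x y z : G) : x ** y = x ** z -> y = z.
Proof.
  intros e; rewrite <- (gone_l G y), <- (gone_l G z), <- (inv_mul G x), <- !gassoc, e; reflexivity.
Qed.

Lemma mul_cancel_r (G : group) (x y z : G) : y ** x = z ** x -> y = z.
Proof.
  intros e; rewrite <- (mul_assoc_inv G y x), e; apply mul_assoc_inv.
Qed.

Lemma inv_unique (G : group) (x y : G) : x ** y = gone -> y = inv x.
Proof. intros e; apply (mul_cancel_l G x); rewrite e, mul_inv; reflexivity. Qed.

Lemma inv_inv (G : group) (x : G) : inv (inv x) = x.
Proof. symmetry; apply inv_unique, inv_mul. Qed.

Lemma inv_one (G : group) : inv (@gone G) = gone.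
Proof. symmetry; apply inv_unique, gone_l. Qed.

Lemma inv_prod (G : group) (x y : G) : inv (x ** y) = inv y ** inv x.
Proof.
  symmetry; apply inv_unique.
  rewrite gassoc, mul_assoc_inv; apply mul_inv.
Qed.

Lemma commutator_one (G : group) (x y : G) :
  x ** y ** inv x ** inv y = gone -> x ** y = y ** x.
Proof.
  intros e; rewrite <- (gone_l G (y ** x)), <- e, gassoc, !mul_inv_assoc; reflexivity.
Qed.

Lemma hom_one (G H : group) (p : G -> H) : is_hom G H p -> p gone = gone.
Proof.
  intros hp; apply (mul_cancel_l H (p gone)).
  rewrite <- hp, gone_r, gone_r; reflexivity.
Qed.

Lemma hom_inv (G H : group) (p : G -> H) x : is_hom G H p -> p (inv x) = inv (p x).
Proof.
  intros hp; apply inv_unique; rewrite <- hp, mul_inv; apply hom_one, hp.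
Qed.

Lemma hom_commutator (G H : group) (p : G -> H) x y : is_hom G H p ->
  p (x ** y ** inv x ** inv y) = p x ** p y ** inv (p x) ** inv (p y).
Proof.
  intros hp; rewrite !hp, (hom_inv G H p x hp), (hom_inv G H p y hp); reflexivity.
Qed.

(** * Integer powers *)

Fixpoint npow {G : group} (x : G) (n : nat) : G :=
  match n with O => gone | S m => x ** npow x m end.

Definition zpow {G : group} (x : G) (k : Z) : G :=
  match k with
  | Z0 => gone
  | Zpos p => npow x (Pos.to_nat p)
  | Zneg p => npow (inv x) (Pos.to_nat p)
  end.

Lemma zpow_of_nat (G : group) (x : G) n : zpow x (Z.of_nat n) = npow x n.
Proof.
  destruct n; [reflexivity|].
  unfold zpow; simpl Z.of_nat; cbv beta iota; now rewrite SuccNat2Pos.id_succ.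
Qed.

Lemma zpow_opp_nat (G : group) (x : G) n : zpow x (- Z.of_nat n) = npow (inv x) n.
Proof.
  destruct n; [reflexivity|].
  unfold zpow; simpl Z.of_nat; simpl Z.opp; cbv beta iota; now rewrite SuccNat2Pos.id_succ.
Qed.

Lemma zpow_succ_l (G : group) (x : G) k : zpow x (k + 1) = x ** zpow x k.
Proof.
  destruct (Z_le_gt_dec 0 k) as [h|h].
  - replace k with (Z.of_nat (Z.to_nat k)) by lia.
    replace (Z.of_nat (Z.to_nat k) + 1) with (Z.of_nat (S (Z.to_nat k))) by lia.
    rewrite !zpow_of_nat; reflexivity.
  - replace k with (- Z.of_nat (S (Z.to_nat (- k - 1)))) by lia.
    replace (- Z.of_nat (S (Z.to_nat (- k - 1))) + 1)
      with (- Z.of_nat (Z.to_nat (- k - 1))) by lia.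
    rewrite !zpow_opp_nat; simpl.
    rewrite gassoc, mul_inv, gone_l; reflexivity.
Qed.

Lemma zpow_pred_l (G : group) (x : G) k : zpow x (k - 1) = inv x ** zpow x k.
Proof.
  apply (mul_cancel_l G x); rewrite <- zpow_succ_l, gassoc, mul_inv, gone_l.
  f_equal; lia.
Qed.

Lemma zpow_add (G : group) (x : G) k l : zpow x (k + l) = zpow x k ** zpow x l.
Proof.
  pattern k; revert k; refine (Z_ind_iff _ _ _).
  - simpl; symmetry; apply gone_l.
  - intros j; split; intros e.
    + replace (j + 1 + l) with (j + l + 1) by lia.
      rewrite !zpow_succ_l, e, gassoc; reflexivity.
    + apply (mul_cancel_l G x).
      rewrite gassoc, <- !zpow_succ_l, <- e; f_equal; lia.
Qed.

Lemma zpow_one (G : group) (x : G) : zpow x 1 = x.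
Proof. apply gone_r. Qed.

Lemma zpow_opp_one (G : group) (x : G) : zpow x (-1) = inv x.
Proof. apply gone_r. Qed.

Lemma zpow_opp (G : group) (x : G) k : zpow x (- k) = inv (zpow x k).
Proof.
  apply inv_unique; rewrite <- zpow_add, Z.add_opp_diag_r; reflexivity.
Qed.

Lemma zpow_intertwine (G : group) (a x y : G) k :
  a ** x = y ** a -> a ** zpow x k = zpow y k ** a.
Proof.
  intros e; revert k; refine (Z_ind_iff _ _ _).
  - simpl; rewrite gone_l, gone_r; reflexivity.
  - intros k; rewrite !zpow_succ_l, gassoc, e, <- !gassoc; split; [intros ->; auto|].
    apply mul_cancel_l.
Qed.

Lemma hom_npow (G H : group) (p : G -> H) x n :
  is_hom G H p -> p (npow x n) = npow (p x) n.
Proof.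
  intros hp; induction n as [|n IH]; simpl; [apply hom_one, hp|].
  rewrite hp, IH; reflexivity.
Qed.

Lemma hom_zpow (G H : group) (p : G -> H) x k :
  is_hom G H p -> p (zpow x k) = zpow (p x) k.
Proof.
  intros hp; destruct k; simpl.
  - apply hom_one, hp.
  - apply hom_npow, hp.
  - rewrite hom_npow, hom_inv by assumption; reflexivity.
Qed.

(** * Subgroups and generation *)

Record subgroup {G : group} (P : G -> Prop) : Prop := {
  sub_one : P gone;
  sub_mul : forall x y, P x -> P y -> P (x ** y);
  sub_inv : forall x, P x -> P (inv x)
}.

Lemma sub_npow (G : group) (P : G -> Prop) x n : subgroup P -> P x -> P (npow x n).
Proof.
  intros hP hx; induction n; simpl; [apply sub_one; auto|apply sub_mul; auto].
Qed.

Lemma sub_zpow (G : group) (P : G -> Prop) x k : subgroup P -> P x -> P (zpow x k).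
Proof.
  intros hP hx; destruct k; simpl;
    [apply sub_one|apply sub_npow|apply sub_npow; [|apply sub_inv]]; auto.
Qed.

Lemma subgroup_preimage (G H : group) (q : G -> H) (P : H -> Prop) :
  is_hom G H q -> subgroup P -> subgroup (fun x => P (q x)).
Proof.
  intros hq hP; split; intros.
  - rewrite hom_one by auto; apply hP.
  - rewrite hq; apply hP; auto.
  - rewrite hom_inv by auto; apply hP; auto.
Qed.

Section SubGroup.
Context {G : group} {P : G -> Prop} (hP : subgroup P).

Lemma sig_ext {T : Type} {Q : T -> Prop} (x y : {z : T | Q z}) :
  proj1_sig x = proj1_sig y -> x = y.
Proof.
  destruct x as [x hx], y as [y hy]; simpl; intros e; subst; f_equal; apply proof_irrelevance.
Qed.

Definition subg_mul (x y : {g : G | P g}) : {g : G | P g} :=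
  exist _ (proj1_sig x ** proj1_sig y) (sub_mul P hP _ _ (proj2_sig x) (proj2_sig y)).

Definition subg_one : {g : G | P g} := exist _ gone (sub_one P hP).

Definition sub_group : group.
Proof.
  refine (Group {g : G | P g} subg_mul subg_one _ _ _ _).
  - intros; apply sig_ext, gassoc.
  - intros; apply sig_ext, gone_l.
  - intros; apply sig_ext, gone_r.
  - intros x; exists (exist _ (inv (proj1_sig x)) (sub_inv P hP _ (proj2_sig x))).
    split; apply sig_ext; [apply mul_inv|apply inv_mul].
Defined.

Definition sub_incl (x : sub_group) : G := proj1_sig x.

Lemma sub_incl_hom : is_hom sub_group G sub_incl.
Proof. intros x y; reflexivity. Qed.

Lemma sub_incl_inj : injective sub_incl.
Proof. intros x y; apply sig_ext. Qed.

Lemma sub_lift (g : G) : P g -> exists x, sub_incl x = g.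
Proof. intros h; exists (exist _ g h); reflexivity. Qed.

Lemma sub_incl_in (x : sub_group) : P (sub_incl x).
Proof. exact (proj2_sig x). Qed.

End SubGroup.
Arguments sub_group {G P} hP.
Arguments sub_incl {G P} hP.

(** Unlike [in_gen], the generating set is a predicate, possibly infinite, and inversion is the
    function [inv]. *)
Inductive gen {G : group} (S : G -> Prop) : G -> Prop :=
| gen_one : gen S gone
| gen_base x : S x -> gen S x
| gen_inv x : gen S x -> gen S (inv x)
| gen_mul x y : gen S x -> gen S y -> gen S (x ** y).

Lemma gen_subgroup (G : group) (S : G -> Prop) : subgroup (gen S).
Proof. split; [apply gen_one|apply gen_mul|apply gen_inv]. Qed.

Lemma gen_mono (G : group) (S T : G -> Prop) x :
  (forall y, S y -> gen T y) -> gen S x -> gen T x.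
Proof. intros h; induction 1; auto using gen_one, gen_inv, gen_mul. Qed.

(** An induction principle for properties that are not visibly stable under inversion. *)
Lemma gen_ind_monoid (G : group) (S Q : G -> Prop) :
  Q gone -> (forall x, S x -> Q x /\ Q (inv x)) ->
  (forall x y, Q x -> Q y -> Q (x ** y)) -> forall x, gen S x -> Q x.
Proof.
  intros h1 hS hm x hx.
  enough (h : Q x /\ Q (inv x)) by apply h.
  induction hx as [|x hx|x _ [a b]|x y _ [a b] _ [a' b']].
  - rewrite inv_one; auto.
  - auto.
  - rewrite inv_inv; auto.
  - rewrite inv_prod; auto.
Qed.

Lemma gen_empty (G : group) (S : G -> Prop) x : (forall y, ~ S y) -> gen S x -> x = gone.
Proof.
  intros h; induction 1 as [|y hy|y _ ->|y z _ -> _ ->]; auto.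
  - destruct (h y hy).
  - apply inv_one.
  - apply gone_l.
Qed.

Lemma gen_of_in_gen (G : group) (l : list G) x : in_gen G l x -> gen (fun y => In y l) x.
Proof.
  induction 1.
  - apply gen_one.
  - apply gen_base; auto.
  - rewrite (inv_unique G x y) by auto; apply gen_inv; auto.
  - apply gen_mul; auto.
Qed.

Definition int_group : group.
Proof.
  refine (Group Z Z.add 0 _ _ _ _); intros; try lia.
  exists (- x); lia.
Defined.

(** * Elementary amenable groups *)

(** A group is the directed union of the one-member family consisting of itself, so the hierarchy is
    increasing. *)
Lemma EGstep_incl (P : group -> Prop) G : P G -> EGstep P G.
Proof.
  intros h; right; exists unit, (fun _ => G), (fun _ x => x).
  split; [auto|]; split; [intros _; split; [intros x y; reflexivity|intros x y; auto]|].
  split; [intros i k; exists tt; split; intros x; exists x; reflexivity|].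
  intros g; exists tt, g; reflexivity.
Qed.

Lemma EGfin_le k l G : (k <= l)%nat -> EGfin k G -> EGfin l G.
Proof. induction 1; intros h; [assumption|]; apply (EGstep_incl (EGfin m)); auto. Qed.

Lemma kernel_subgroup (G H : group) (p : G -> H) :
  is_hom G H p -> subgroup (fun x => p x = gone).
Proof.
  intros hp; split.
  - apply hom_one, hp.
  - intros x y ex ey; rewrite hp, ex, ey; apply gone_l.
  - intros x ex; rewrite hom_inv, ex by auto; apply inv_one.
Qed.

Lemma extension_of_hom (P : group -> Prop) (G Q : group) (p : G -> Q)
  (hp : is_hom G Q p) :
  P (sub_group (kernel_subgroup G Q p hp)) -> P Q -> surjective p -> is_extension P G.
Proof.
  intros hN hQ hs; exists (sub_group (kernel_subgroup G Q p hp)), Q, (sub_incl _), p.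
  split; [exact hN|]; split; [exact hQ|]; split; [apply sub_incl_hom|].
  split; [apply sub_incl_inj|]; split; [assumption|]; split; [assumption|].
  intros g; split; [intros e; exact (sub_lift _ g e)|intros [n <-]; exact (sub_incl_in _ n)].
Qed.

(** * The index set Z + Z *)

Definition idx := (bool * Z)%type.

Definition ilt (a b : idx) : Prop :=
  match fst a, fst b with
  | false, true => True
  | true, false => False
  | _, _ => snd a < snd b
  end.

Definition shift (k : Z) (l : idx) : idx := (fst l, snd l + k).

Definition inner (l : idx) : Prop := fst l = false.

Ltac idx_tac :=
  repeat match goal with x : idx |- _ => destruct x as [[] ?] end;
  unfold ilt, shift, inner in *; simpl in *;
  try discriminate; try lia; try tauto; try (f_equal; lia).

Lemma ilt_irrefl l : ~ ilt l l.
Proof. idx_tac. Qed.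

Lemma ilt_trans a b c : ilt a b -> ilt b c -> ilt a c.
Proof. idx_tac. Qed.

Lemma ilt_total a b : ilt a b \/ a = b \/ ilt b a.
Proof.
  destruct a as [a i], b as [b j]; destruct a, b; unfold ilt; simpl; auto;
  destruct (Z.lt_total i j) as [?|[->|?]]; auto.
Qed.

Lemma ilt_neq a b : ilt a b -> a <> b.
Proof. intros h ->; exact (ilt_irrefl _ h). Qed.

Lemma shift_shift j k l : shift j (shift k l) = shift (k + j) l.
Proof. destruct l; unfold shift; simpl; f_equal; lia. Qed.

Lemma shift_zero l : shift 0 l = l.
Proof. destruct l; unfold shift; simpl; f_equal; lia. Qed.

Lemma shift_fix k l : shift k l = l -> k = 0.
Proof. destruct l; unfold shift; simpl; intros e; injection e; lia. Qed.

Definition fin (P : idx -> Prop) : Prop := exists ls, forall l, P l -> In l ls.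

Lemma fin_or P Q : fin P -> fin Q -> fin (fun l => P l \/ Q l).
Proof.
  intros [p hp] [q hq]; exists (p ++ q); intros l [h|h]; apply in_or_app; auto.
Qed.

(** Induction on the enumerating list, comparing its head with an extremal element of the rest.
    Keeping the order as a parameter gives maxima and minima together. *)
Lemma extremum (R : idx -> idx -> Prop) P :
  (forall a b, R a b \/ a = b \/ R b a) -> (forall a b c, R a b -> R b c -> R a c) ->
  (forall a, ~ R a a) ->
  fin P -> (exists l, P l) -> exists l, P l /\ forall m, P m -> ~ R l m.
Proof.
  intros ht htr hi [ls h]; revert P h; induction ls as [|a ls IH]; intros P h hex; destruct hex as [l hl].
  - destruct (h l hl).
  - destruct (classic (exists m, P m /\ m <> a)) as [[m hm]|hn].
    + destruct (IH (fun l => P l /\ l <> a)) as [x [[hx hxa] hmax]].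
      * intros y [hy ne]; destruct (h y hy) as [->|]; [destruct ne|]; auto.
      * exists m; exact hm.
      * destruct (classic (P a /\ R x a)) as [[hPa hR]|hno].
        -- exists a; split; auto; intros y hy hRy.
           destruct (classic (y = a)) as [->|ne]; [apply (hi a hRy)|].
           apply (hmax y); eauto.
        -- exists x; split; auto; intros y hy hRy.
           destruct (classic (y = a)) as [->|ne]; [apply hno; auto|].
           apply (hmax y); auto.
    + exists l; split; auto; intros m hm.
      assert (l = a) by (apply NNPP; intros ?; apply hn; eauto).
      assert (m = a) by (apply NNPP; intros ?; apply hn; eauto).
      subst; apply hi.
Qed.

Lemma max_exists P : fin P -> (exists l, P l) -> exists l, P l /\ forall m, P m -> ~ ilt l m.
Proof. apply extremum; [apply ilt_total|apply ilt_trans|apply ilt_irrefl]. Qed.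

Lemma min_exists P : fin P -> (exists l, P l) -> exists l, P l /\ forall m, P m -> ~ ilt m l.
Proof.
  apply (extremum (fun a b => ilt b a)).
  - intros a b; destruct (ilt_total a b) as [|[|]]; auto.
  - intros a b c h1 h2; apply (ilt_trans _ b); auto.
  - intros a; apply ilt_irrefl.
Qed.

Lemma fresh_inner P : fin P -> exists i, forall j, i <= j -> ~ P (false, j).
Proof.
  intros [ls h].
  enough (hi : exists i, forall j, i <= j -> ~ In (false, j) ls)
    by (destruct hi as [i hi]; exists i; intros j hj hP; apply (hi j hj); auto).
  clear h; induction ls as [|[b k] ls [i IH]].
  - exists 0; auto.
  - exists (Z.max i (k + 1)); intros j hj [e|hin].
    + injection e; lia.
    + apply (IH j); auto; lia.
Qed.

Lemma low_inner P : fin P -> exists i, forall j, j <= i -> ~ P (false, j).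
Proof.
  intros [ls h].
  enough (hi : exists i, forall j, j <= i -> ~ In (false, j) ls)
    by (destruct hi as [i hi]; exists i; intros j hj hP; apply (hi j hj); auto).
  clear h; induction ls as [|[b k] ls [i IH]].
  - exists 0; auto.
  - exists (Z.min i (k - 1)); intros j hj [e|hin].
    + injection e; lia.
    + apply (IH j); auto; lia.
Qed.

(** * Groups of triangular permutations *)

Lemma shift_pow (A : group) (f : idx -> A) (t : A) :
  (forall l, t ** f l = f (shift 1 l) ** t) ->
  forall k l, zpow t k ** f l = f (shift k l) ** zpow t k.
Proof.
  intros tf; refine (Z_ind_iff _ _ _).
  - intros; change (zpow t 0) with (@gone A); rewrite shift_zero, gone_l, gone_r; auto.
  - intros k; split; intros h l; [|specialize (h l); revert h]; rewrite zpow_succ_l.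
    + rewrite <- gassoc, h, gassoc, tf, shift_shift, <- gassoc; reflexivity.
    + rewrite <- shift_shift, <- gassoc, gassoc, (gassoc _ _ t), <- tf, <- !gassoc.
      apply mul_cancel_l.
Qed.

Section Tri.
Context {A : group} {X : Type} (act : A -> X -> X) (co : X -> idx -> Z) (o : X)
  (f : idx -> A) (t : A).

Definition W (P : idx -> Prop) : A -> Prop := gen (fun a => exists l, P l /\ a = f l).

Definition up0 (l : idx) (x : X) : Prop := forall m, ilt l m -> co x m = 0.

(** A permutation model of the iterated wreath product: points carry integer coordinates, and [f l]
    raises coordinate [l] when all higher coordinates vanish and fixes the point otherwise. The
    letter [t] translates the index set. *)
Record chain_action : Prop := {
  act_one : forall x, act gone x = x;
  act_mul : forall a b x, act (a ** b) x = act a (act b x);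
  co_inj : forall x y, (forall l, co x l = co y l) -> x = y;
  co_o : forall l, co o l = 0;
  f_same : forall l x, up0 l x -> co (act (f l) x) l = co x l + 1;
  f_diff : forall l m x, m <> l -> co (act (f l) x) m = co x m;
  f_off : forall l x, ~ up0 l x -> act (f l) x = x;
  t_co : forall x l, co (act t x) (shift 1 l) = co x l;
  t_f : forall l, t ** f l = f (shift 1 l) ** t;
  A_gen : forall a, gen (fun s => s = f (false, 0) \/ s = f (true, 0) \/ s = t) a;
  faithW : forall w, W (fun _ => True) w -> (forall x, act w x = x) -> w = gone
}.

Context (H : chain_action).

Lemma act_Vl a x : act (inv a) (act a x) = x.
Proof. rewrite <- (act_mul H), inv_mul; apply H. Qed.

Lemma act_Vr a x : act a (act (inv a) x) = x.
Proof. rewrite <- (act_mul H), mul_inv; apply H. Qed.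

Lemma up0_f l x : up0 l (act (f l) x) <-> up0 l x.
Proof.
  split; intros h m hm; specialize (h m hm);
  rewrite (f_diff H) in * by (intros ->; apply (ilt_irrefl _ hm)); auto.
Qed.

Lemma fV_diff l m x : m <> l -> co (act (inv (f l)) x) m = co x m.
Proof. intros h; rewrite <- (f_diff H l) by auto; rewrite act_Vr; reflexivity. Qed.

Lemma up0_fV l x : up0 l (act (inv (f l)) x) <-> up0 l x.
Proof. rewrite <- up0_f, act_Vr; reflexivity. Qed.

Lemma fV_same l x : up0 l x -> co (act (inv (f l)) x) l = co x l - 1.
Proof.
  intros h; rewrite <- up0_fV in h; apply (f_same H) in h; rewrite act_Vr in h; lia.
Qed.

Lemma fV_off l x : ~ up0 l x -> act (inv (f l)) x = x.
Proof.
  intros h; rewrite <- up0_fV in h; apply (f_off H) in h; rewrite act_Vr in h; auto.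
Qed.

Lemma W_sub P : subgroup (W P).
Proof. apply gen_subgroup. Qed.

Lemma W_f (P : idx -> Prop) l : P l -> W P (f l).
Proof. intros h; apply gen_base; eauto. Qed.

Lemma W_mono (P Q : idx -> Prop) w : (forall l, P l -> Q l) -> W P w -> W Q w.
Proof. intros h; apply gen_mono; intros y [l [hl ->]]; apply W_f; auto. Qed.

Lemma W_ind (P : idx -> Prop) (Q : A -> Prop) :
  Q gone -> (forall l, P l -> Q (f l) /\ Q (inv (f l))) ->
  (forall a b, W P a -> W P b -> Q a -> Q b -> Q (a ** b)) -> forall w, W P w -> Q w.
Proof.
  intros h1 hf hm w hw.
  enough (e : W P w /\ Q w) by apply e.
  revert w hw; apply gen_ind_monoid.
  - split; [apply gen_one|auto].
  - intros x [l [hl ->]]; destruct (hf l hl).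
    repeat split; auto; [apply W_f|apply gen_inv, W_f]; auto.
  - intros x y [] []; split; [apply gen_mul|]; auto.
Qed.

(** Triangularity: the change at one coordinate is a function of the higher ones. Each generator has
    this property. It survives products because two points that agree above [l] have images that
    agree above [l]. *)
Lemma W_tri P w : W P w -> forall l x y, (forall m, ilt l m -> co x m = co y m) ->
  co (act w x) l - co x l = co (act w y) l - co y l.
Proof.
  revert w; refine (W_ind P _ _ _ _).
  - intros; rewrite !(act_one H); lia.
  - intros l _; split; intros m x y h; (destruct (classic (m = l)) as [->|ne];
      [|rewrite ?(f_diff H), ?fV_diff by auto; lia]);
    (assert (e : up0 l x <-> up0 l y)
      by (split; intros u k hk; [rewrite <- h|rewrite h]; auto));
    (destruct (classic (up0 l x)) as [u|u]; pose proof u as u'; rewrite e in u').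
    + rewrite !(f_same H) by auto; lia.
    + rewrite !(f_off H) by auto; lia.
    + rewrite !fV_same by auto; lia.
    + rewrite !fV_off by auto; lia.
  - intros a b _ _ ha hb l x y h; rewrite !(act_mul H).
    specialize (hb l x y h) as e.
    enough (co (act a (act b x)) l - co (act b x) l = co (act a (act b y)) l - co (act b y) l)
      by lia.
    apply ha; intros m hm; specialize (h m hm) as e'.
    enough (co (act b x) m - co x m = co (act b y) m - co y m) by lia.
    apply hb; intros k hk; apply h, (ilt_trans _ m); auto.
Qed.

Definition upset (U : idx -> Prop) : Prop := forall a b, U a -> ilt a b -> U b.

Lemma W_agree P w U x y : W P w -> upset U -> (forall m, U m -> co x m = co y m) ->
  forall m, U m -> co (act w x) m = co (act w y) m.
Proof.
  intros hw hU h m hm.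
  enough (co (act w x) m - co x m = co (act w y) m - co y m)
    by (specialize (h m hm); lia).
  eapply W_tri; eauto.
Qed.

Lemma W_out P w l x : W P w -> ~ P l -> co (act w x) l = co x l.
Proof.
  intros hw hl; revert w hw x.
  apply (W_ind P (fun w => forall x, co (act w x) l = co x l)).
  - intros; rewrite (act_one H); auto.
  - intros m hm; assert (l <> m) by congruence.
    split; intros; [apply (f_diff H)|apply fV_diff]; auto.
  - intros a b _ _ ha hb x; rewrite (act_mul H), ha; auto.
Qed.

(** The nonzero coordinate [m] blocks every generator of lower index, and it stays nonzero because
    no generator with index in [P] changes it. *)
Lemma W_below P w m x : W P w -> ~ P m -> co x m <> 0 ->
  forall l, ilt l m -> co (act w x) l = co x l.
Proof.
  intros hw hm hx l hl.
  enough (forall y, co y m <> 0 -> co (act w y) l = co y l) by auto.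
  clear x hx; revert w hw.
  apply (W_ind P (fun w => forall x, co x m <> 0 -> co (act w x) l = co x l)).
  - intros; rewrite (act_one H); auto.
  - intros k hk; split; intros x hx;
      (destruct (classic (l = k)) as [<-|ne]; [|apply (f_diff H) || apply fV_diff; auto]);
      rewrite ?(f_off H), ?fV_off; auto; intros u; apply hx, u; auto.
  - intros a b _ hb ha hb' x hx; rewrite (act_mul H), ha, hb'; auto.
    rewrite (W_out P); auto.
Qed.

Lemma W_trivial P w : W P w -> (forall x, act w x = x) -> w = gone.
Proof. intros hw; apply (faithW H); revert hw; apply W_mono; auto. Qed.

Lemma W_eq P Q a b : W P a -> W Q b -> (forall x, act a x = act b x) -> a = b.
Proof.
  intros ha hb h; apply (mul_cancel_r A (inv b)); rewrite mul_inv.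
  apply (W_trivial (fun _ => True)).
  - apply gen_mul; [|apply gen_inv]; [apply (W_mono P)|apply (W_mono Q)]; auto.
  - intros x; rewrite (act_mul H), h, act_Vr; auto.
Qed.

Lemma W_fin P w : W P w -> exists Q, fin Q /\ (forall l, Q l -> P l) /\ W Q w.
Proof.
  revert w; refine (W_ind P _ _ _ _).
  - exists (fun _ => False); repeat split; try tauto; [exists nil; auto|apply gen_one].
  - intros l hl; split; exists (fun m => m = l); (split; [exists (l :: nil)%list; simpl; auto|]);
      (split; [congruence|]); [apply W_f|apply gen_inv, W_f]; auto.
  - intros a b _ _ [Q [hQ [h1 h2]]] [R [hR [h3 h4]]].
    exists (fun l => Q l \/ R l); split; [apply fin_or; auto|]; split; [intros l []; auto|].
    apply gen_mul; [apply (W_mono Q)|apply (W_mono R)]; auto.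
Qed.

Lemma f_one_o l : co (act (f l) o) l = 1.
Proof. rewrite (f_same H), (co_o H); auto; intros m _; apply H. Qed.

Lemma fpow_o l k : co (act (zpow (f l) k) o) l = k
  /\ (forall m, m <> l -> co (act (zpow (f l) k) o) m = 0).
Proof.
  revert k; refine (Z_ind_iff _ _ _).
  - simpl; rewrite (act_one H); split; intros; apply H.
  - intros k; rewrite zpow_succ_l, (act_mul H).
    assert (e : forall m, m <> l -> co (act (f l) (act (zpow (f l) k) o)) m
      = co (act (zpow (f l) k) o) m) by (intros; apply H; auto).
    split; intros [h1 h2].
    + split; [|intros; rewrite e; auto].
      rewrite (f_same H), h1; auto.
      intros m hm; apply h2; intros ->; exact (ilt_irrefl _ hm).
    + assert (h3 : forall m, m <> l -> co (act (zpow (f l) k) o) m = 0)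
        by (intros; rewrite <- e; auto).
      split; auto.
      rewrite (f_same H) in h1; [lia|].
      intros m hm; apply h3; intros ->; exact (ilt_irrefl _ hm).
Qed.

(** ** Conjugation by powers of [t] and normal form *)

Lemma tpow_co k x l : co (act (zpow t k) x) (shift k l) = co x l.
Proof.
  revert k x l; refine (Z_ind_iff _ _ _).
  - intros; change (zpow t 0) with (@gone A); rewrite shift_zero, (act_one H); auto.
  - intros k; split; intros h x l; [|specialize (h x l); revert h];
    rewrite zpow_succ_l, (act_mul H), <- shift_shift, (t_co H); auto.
Qed.

Lemma tpow_f k l : zpow t k ** f l = f (shift k l) ** zpow t k.
Proof. apply shift_pow, H. Qed.

Definition cj (a x : A) : A := a ** x ** inv a.

Lemma conj_mul a x y : cj a (x ** y) = cj a x ** cj a y.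
Proof. unfold cj; rewrite !gassoc, mul_inv_assoc; reflexivity. Qed.

Lemma conj_inv a x : cj a (inv x) = inv (cj a x).
Proof. unfold cj; rewrite !inv_prod, inv_inv, gassoc; reflexivity. Qed.

Lemma conj_one a : cj a gone = gone.
Proof. unfold cj; rewrite gone_r, mul_inv; reflexivity. Qed.

Lemma act_conj a x y : act (cj a x) y = act a (act x (act (inv a) y)).
Proof. unfold cj; rewrite !(act_mul H); reflexivity. Qed.

Lemma conj_tf k l : cj (zpow t k) (f l) = f (shift k l).
Proof. unfold cj; rewrite tpow_f, mul_assoc_inv; reflexivity. Qed.

Lemma conj_tW k P w : W P w -> W (fun l => P (shift (- k) l)) (cj (zpow t k) w).
Proof.
  revert w; refine (W_ind P _ _ _ _).
  - rewrite conj_one; apply gen_one.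
  - intros l hl; rewrite conj_inv, conj_tf.
    assert (hf : W (fun l => P (shift (- k) l)) (f (shift k l)))
      by (apply W_f; rewrite shift_shift; replace (k + - k) with 0 by lia;
          rewrite shift_zero; auto).
    split; [|apply gen_inv]; auto.
  - intros; rewrite conj_mul; apply gen_mul; auto.
Qed.

(** Normal form in the semidirect product of [W P] by the powers of [t]. *)
Definition nf (P : idx -> Prop) (a : A) : Prop :=
  exists w k, W P w /\ a = w ** zpow t k.

Definition shift_stable (P : idx -> Prop) : Prop := forall k l, P l -> P (shift k l).

Lemma conj_tW_stable P k w : shift_stable P -> W P w -> W P (cj (zpow t k) w).
Proof.
  intros hP hw; apply (conj_tW k) in hw; revert hw; apply W_mono.
  intros l hl; apply (hP k) in hl; rewrite shift_shift in hl.
  replace (- k + k) with 0 in hl by lia; rewrite shift_zero in hl; auto.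
Qed.

Lemma nf_subgroup P : shift_stable P -> subgroup (nf P).
Proof.
  intros hP; split.
  - exists gone, 0; split; [apply gen_one|symmetry; apply gone_l].
  - intros x y (w & k & hw & ->) (v & l & hv & ->).
    exists (w ** cj (zpow t k) v), (k + l); split.
    + apply gen_mul; auto; apply conj_tW_stable; auto.
    + unfold cj; rewrite zpow_add, !gassoc, mul_inv_assoc; reflexivity.
  - intros x (w & k & hw & ->).
    exists (cj (zpow t (- k)) (inv w)), (- k); split.
    + apply conj_tW_stable; auto; apply gen_inv; auto.
    + unfold cj; rewrite inv_prod, mul_inv_assoc, <- zpow_opp; reflexivity.
Qed.

Lemma nf_t P : nf P t.
Proof. exists gone, 1; rewrite gone_l, zpow_one; split; auto; apply gen_one. Qed.

Lemma nf_W P w : W P w -> nf P w.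
Proof. exists w, 0; split; auto; symmetry; apply gone_r. Qed.

Lemma all_nf a : nf (fun _ => True) a.
Proof.
  assert (hs : subgroup (nf (fun _ => True))) by (apply nf_subgroup; intros ? ? ?; auto).
  induction (A_gen H a) as [|x [->|[->| ->]]|x _ IH|x y _ IH _ IH']; try (apply hs; assumption).
  - apply nf_W, W_f; auto.
  - apply nf_W, W_f; auto.
  - apply nf_t.
Qed.

(** An element of [W P] changes only finitely many coordinates, whereas a nontrivial power of [t]
    shifts coordinates of arbitrarily high index. *)
Lemma tpow_W P k : W P (zpow t k) -> k = 0.
Proof.
  intros hw; destruct (W_fin _ _ hw) as [Q [hQ [_ hw']]].
  destruct (fresh_inner _ hQ) as [i hi]; specialize (hi i (Z.le_refl i)).
  apply NNPP; intros hk.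
  (* The point whose only nonzero coordinate sits at [i - k] is sent to one with a 1 at [i], a
     coordinate that words over [Q] cannot change. *)
  pose proof (tpow_co k (act (f (false, i - k)) o) (false, i - k)) as e.
  rewrite f_one_o in e; unfold shift in e; simpl in e.
  replace (i - k + k) with i in e by lia.
  rewrite (W_out Q), (f_diff H), (co_o H) in e; auto; [discriminate|].
  intros e'; injection e'; lia.
Qed.

Lemma nf_unique P Q w v k l : W P w -> W Q v ->
  w ** zpow t k = v ** zpow t l -> k = l.
Proof.
  intros hw hv e.
  enough (k - l = 0) by lia; apply (tpow_W (fun _ => True)).
  replace (zpow t (k - l)) with (inv w ** v).
  - apply gen_mul; [apply gen_inv|]; eapply W_mono; eauto; auto.
  - apply (mul_cancel_l A w); apply (mul_cancel_r A (zpow t l)).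
    rewrite gassoc, mul_inv, gone_l, <- e, <- gassoc, <- zpow_add.
    do 2 f_equal; lia.
Qed.

Lemma nf_in_W P a : ~ W P a -> nf P a -> exists w k, W P w /\ a = w ** zpow t k /\ k <> 0.
Proof.
  intros ha (w & k & hw & e); exists w, k; repeat split; auto.
  intros ->; apply ha; rewrite e; simpl; rewrite gone_r; auto.
Qed.

Lemma conj_W_all a w : W (fun _ => True) w -> W (fun _ => True) (cj a w).
Proof.
  destruct (all_nf a) as (v & k & hv & ->); intros hw.
  replace (cj (v ** zpow t k) w) with (v ** cj (zpow t k) w ** inv v).
  - apply gen_mul; [apply gen_mul|apply gen_inv]; auto.
    apply conj_tW_stable; auto; intros ? ? ?; auto.
  - unfold cj; rewrite inv_prod, !gassoc; reflexivity.
Qed.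

(** Modulo [W] the group is generated by [t], hence abelian. The computation writes the commutator
    as a product of conjugates of elements of [W]. *)
Lemma commutator_W a b : W (fun _ => True) (a ** b ** inv a ** inv b).
Proof.
  destruct (all_nf a) as (v & k & hv & ->), (all_nf b) as (w & l & hw & ->).
  set (T := zpow t k); set (U := zpow t l).
  assert (eTU : T ** U = U ** T)
    by (unfold T, U; rewrite <- !zpow_add; f_equal; lia).
  assert (e : cj (v ** T) U = v ** U ** inv v).
  { unfold cj; rewrite inv_prod, !gassoc, <- (gassoc _ v T U), eTU, gassoc, mul_assoc_inv.
    reflexivity. }
  change (W (fun _ => True) (cj (v ** T) (w ** U) ** inv (w ** U))).
  rewrite conj_mul, e, inv_prod.
  replace (cj (v ** T) w ** (v ** U ** inv v) ** (inv U ** inv w))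
    with (cj (v ** T) w ** v ** cj U (inv v) ** inv w)
    by (unfold cj; rewrite !gassoc; reflexivity).
  apply gen_mul; [apply gen_mul; [apply gen_mul|]|apply gen_inv]; auto;
    apply conj_W_all; auto; apply gen_inv; auto.
Qed.

(** ** Levels *)

Definition moves (w : A) (l : idx) : Prop := exists x, co (act w x) l <> co x l.

Definition top (w : A) (l : idx) : Prop := moves w l /\ forall m, ilt l m -> ~ moves w m.

Lemma not_moves w l x : ~ moves w l -> co (act w x) l = co x l.
Proof. intros h; apply NNPP; intros e; apply h; exists x; auto. Qed.

Lemma moves_in P w l : W P w -> moves w l -> P l.
Proof.
  intros hw [x hx]; apply NNPP; intros hP; apply hx, (W_out P); auto.
Qed.

Lemma top_exists P w : W P w -> w <> gone -> exists l, top w l /\ P l.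
Proof.
  intros hw hne; destruct (W_fin P w hw) as [Q [[ls hQ] [hQP hwQ]]].
  destruct (max_exists (moves w)) as [l [hl hmax]].
  - exists ls; intros m hm; apply hQ, (moves_in Q w); auto.
  - apply NNPP; intros hn; apply hne, (W_trivial P); auto.
    intros x; apply (co_inj H); intros l; apply not_moves; eauto.
  - exists l; split; [|apply (moves_in P w); auto].
    split; auto; intros m hm hmm; exact (hmax m hmm hm).
Qed.

Lemma top_unique w l m : top w l -> top w m -> l = m.
Proof.
  intros [h1 h2] [h3 h4]; destruct (ilt_total l m) as [h|[h|h]]; auto;
  [destruct (h2 m h h3)|destruct (h4 l h h1)].
Qed.

(** By triangularity [w] acts on the coordinates above [l] as if [x] were absent, and it changes
    coordinate [l] by the same amount before and after [x]; so the level of [x] is kept. *)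
Lemma top_conj_W P x w l : W P w -> top x l -> top (cj w x) l.
Proof.
  intros hw [[z hz] h].
  assert (e : forall y m, ilt l m -> co (act x y) m = co y m)
    by (intros; apply not_moves; auto).
  split.
  - exists (act w z); rewrite act_conj, act_Vl; intros e'; apply hz.
    enough (co (act w (act x z)) l - co (act x z) l = co (act w z) l - co z l) by lia.
    apply (W_tri P); auto.
  - intros m hm [y hy]; apply hy; rewrite act_conj.
    rewrite (W_agree P w (ilt l) (act x (act (inv w) y)) (act (inv w) y)); auto.
    + rewrite act_Vr; auto.
    + intros a b; apply ilt_trans.
Qed.

Lemma top_conj_t x k l : top x l -> top (cj (zpow t k) x) (shift k l).
Proof.
  intros [[z hz] h]; split.
  - exists (act (zpow t k) z); rewrite act_conj, act_Vl, !tpow_co; auto.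
  - intros m hm [y hy]; apply hy; rewrite act_conj.
    assert (e : m = shift k (shift (- k) m))
      by (rewrite shift_shift; replace (- k + k) with 0 by lia; rewrite shift_zero; auto).
    rewrite e, tpow_co, not_moves.
    + rewrite <- (tpow_co k), act_Vr; reflexivity.
    + apply h; destruct l as [[] ?], m as [[] ?]; unfold ilt, shift in *; simpl in *; lia.
Qed.

Lemma top_conj P x w k l : W P w -> top x l -> top (cj (w ** zpow t k) x) (shift k l).
Proof.
  intros hw hx.
  replace (cj (w ** zpow t k) x) with (cj w (cj (zpow t k) x))
    by (unfold cj; rewrite inv_prod, !gassoc; reflexivity).
  eapply top_conj_W; eauto; apply top_conj_t; auto.
Qed.

Lemma centralizer_trivial P u x :
  W P x -> ~ W (fun _ => True) u -> u ** x = x ** u -> x = gone.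
Proof.
  intros hx hu e; apply NNPP; intros hne.
  destruct (top_exists P x hx hne) as [l [hl _]].
  destruct (nf_in_W _ u hu (all_nf u)) as (w & k & hw & -> & hk).
  apply hk, (shift_fix k l), (top_unique x); auto.
  replace x with (cj (w ** zpow t k) x)
    by (unfold cj; rewrite e, mul_assoc_inv; reflexivity).
  eapply top_conj; eauto.
Qed.

(** ** Upper bounds on the EA-class *)

(** Deleting the generators outside [U] from a word is enough, since the coordinates in an upset
    evolve independently of the lower ones. *)
Lemma W_restrict P U w : upset U -> W P w ->
  exists w', W (fun l => P l /\ U l) w'
    /\ forall x m, U m -> co (act w' x) m = co (act w x) m.
Proof.
  intros hU; revert w; refine (W_ind P _ _ _ _).
  - exists gone; split; [apply gen_one|auto].
  - intros l hl; destruct (classic (U l)) as [hl'|hl'].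
    + split; [exists (f l)|exists (inv (f l))]; (split; [|auto]);
        [apply W_f|apply gen_inv, W_f]; auto.
    + split; exists gone; (split; [apply gen_one|intros x m hm]); rewrite (act_one H);
        assert (m <> l) by congruence; [rewrite (f_diff H)|rewrite fV_diff]; auto.
  - intros a b ha hb [a' [ha1 ha2]] [b' [hb1 hb2]].
    exists (a' ** b'); split; [apply gen_mul; auto|].
    intros x m hm; rewrite !(act_mul H), ha2 by auto.
    apply (W_agree P a U); auto.
Qed.

(** Induction on the size of the index set. Forgetting the minimal coordinate [l] maps onto the
    group over the remaining indices. The kernel moves only [l], by amounts depending on coordinates
    that it fixes, hence is abelian. *)
Lemma W_EG n : forall P ls, (length ls <= n)%nat -> (forall l, P l -> In l ls) ->
  EGfin n (sub_group (W_sub P)).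
Proof.
  induction n as [|n IH]; intros P ls hlen hls.
  - destruct ls; [|simpl in hlen; lia].
    left; exists (gone :: nil)%list; intros x; left.
    apply sub_incl_inj; symmetry; apply (gen_empty A (fun a => exists l, P l /\ a = f l));
      [intros y [l [hl _]]; exact (hls l hl)|apply (sub_incl_in (W_sub P))].
  - destruct (classic (exists l, P l)) as [hex|hno].
    2: { apply (EGfin_le 0); [lia|]; left; exists (gone :: nil)%list; intros x; left.
         apply sub_incl_inj; symmetry; apply (gen_empty A (fun a => exists l, P l /\ a = f l));
           [intros y [l [hl _]]; apply hno; eauto|apply (sub_incl_in (W_sub P))]. }
    destruct (min_exists P) as [l [hl hmin]]; [exists ls; auto|auto|].
    set (U := ilt l); set (P' := fun m => P m /\ U m).
    assert (hU : upset U) by (intros a b; apply ilt_trans).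
    assert (hout : forall m, ~ U m -> m <> l -> ~ P m)
      by (intros m h1 h2 h3; destruct (ilt_total l m) as [?|[?|?]]; auto;
          apply (hmin m); auto).
    assert (hQ : EGfin n (sub_group (W_sub P'))).
    { apply (IH P' (remove (fun a b => excluded_middle_informative (a = b)) l ls)).
      - assert (hin : In l ls) by auto.
        pose proof (remove_length_lt (fun a b => excluded_middle_informative (a = b)) ls l hin).
        lia.
      - intros m [h1 h2]; apply in_in_remove; auto; intros ->; exact (ilt_irrefl _ h2). }
    assert (hex' : forall w : sub_group (W_sub P), exists w' : sub_group (W_sub P'),
      forall x m, U m -> co (act (sub_incl _ w') x) m = co (act (sub_incl _ w) x) m).
    { intros w; destruct (W_restrict P U _ hU (sub_incl_in _ w)) as [w' [h1 h2]].
      destruct (sub_lift (W_sub P') w' h1) as [v <-]; exists v; auto. }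
    (* Restrictions exist element by element, so the map has to be chosen; [huniq] shows that they
       are unique, and therefore multiplicative. *)
    apply (choice (fun w w' => forall x m, U m ->
      co (act (sub_incl _ w') x) m = co (act (sub_incl _ w) x) m)) in hex' as [p hp].
    assert (huniq : forall a b : sub_group (W_sub P'),
      (forall x m, U m -> co (act (sub_incl _ a) x) m = co (act (sub_incl _ b) x) m) -> a = b).
    { intros a b h; apply sub_incl_inj, (W_eq P' P'); try apply (sub_incl_in (W_sub P')).
      intros x; apply (co_inj H); intros m; destruct (classic (U m)) as [u|u]; auto.
      rewrite !(W_out P'); auto; try apply (sub_incl_in (W_sub P')); intros [? ?]; auto. }
    assert (hom : is_hom (sub_group (W_sub P)) (sub_group (W_sub P')) p).
    { intros a b; apply huniq; intros x m hm.
      rewrite hp, !sub_incl_hom, !(act_mul H), hp by auto.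
      symmetry; apply (W_agree P _ U); auto; apply (sub_incl_in (W_sub P)). }
    left; apply (extension_of_hom _ _ _ p hom).
    + apply (EGfin_le 0); [lia|]; right; intros a b; apply sub_incl_inj, sub_incl_inj.
      assert (ht : forall c : sub_group (kernel_subgroup _ _ p hom), forall x m, U m ->
        co (act (sub_incl _ (sub_incl _ c)) x) m = co x m).
      { intros c x m hm; rewrite <- hp by auto.
        rewrite (sub_incl_in (kernel_subgroup _ _ p hom) c : p (sub_incl _ c) = gone).
        change (co (act gone x) m = co x m); rewrite (act_one H); auto. }
      assert (hW : forall c : sub_group (kernel_subgroup _ _ p hom),
        W P (sub_incl _ (sub_incl _ c))) by (intros c; apply (sub_incl_in (W_sub P))).
      rewrite !sub_incl_hom.
      apply (W_eq P P); [apply gen_mul; apply hW|apply gen_mul; apply hW|].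
      intros x; apply (co_inj H); intros m; rewrite !(act_mul H).
      destruct (classic (U m)) as [u|u]; [rewrite !ht; auto|].
      destruct (classic (m = l)) as [->|ne]; [|rewrite !(W_out P); auto; apply hW].
      (* Each of the two elements translates coordinate [l] by an amount read off from the higher
         coordinates, which the other one fixes; so the translations add up in either order. *)
      pose proof (W_tri P _ (hW a) l (act (sub_incl _ (sub_incl _ b)) x) x) as e1.
      pose proof (W_tri P _ (hW b) l (act (sub_incl _ (sub_incl _ a)) x) x) as e2.
      specialize (e1 ltac:(intros; apply ht; auto)).
      specialize (e2 ltac:(intros; apply ht; auto)).
      lia.
    + exact hQ.
    + intros w.
      assert (hw : W P (sub_incl _ w)).
      { apply (W_mono P'); [intros m [? ?]; auto|apply (sub_incl_in (W_sub P'))]. }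
      destruct (sub_lift (W_sub P) _ hw) as [v hv]; exists v; apply huniq.
      intros x m hm; rewrite hp, hv; auto.
Qed.

Section Cover.
Context {B : group} (q : B -> A) (hq : is_hom B A q).

Definition preW (P : idx -> Prop) : group :=
  sub_group (subgroup_preimage B A q (W P) hq (W_sub P)).

(** The abelian kernel of [q] costs one further extension. With [q] the identity this covers [A]
    itself. *)
Lemma preW_EG P : (forall x y, q x = gone -> q y = gone -> x ** y = y ** x) ->
  fin P -> (forall w, W P w -> exists b, q b = w) -> exists n, EGfin n (preW P).
Proof.
  intros hab [ls hls] hsur.
  exists (S (length ls)).
  set (p := fun x : preW P =>
    exist _ (q (sub_incl _ x)) (sub_incl_in _ x) : sub_group (W_sub P)).
  assert (hom : is_hom (preW P) (sub_group (W_sub P)) p).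
  { intros x y; apply sub_incl_inj; apply (hq (sub_incl _ x) (sub_incl _ y)). }
  left; apply (extension_of_hom _ _ _ p hom).
  - apply (EGfin_le 0); [lia|]; right; intros a b; apply sub_incl_inj, sub_incl_inj.
    rewrite !sub_incl_hom; apply hab.
    + exact (f_equal (sub_incl _) (sub_incl_in (kernel_subgroup _ _ p hom) a)).
    + exact (f_equal (sub_incl _) (sub_incl_in (kernel_subgroup _ _ p hom) b)).
  - apply (W_EG _ P ls); auto.
  - intros w; destruct (hsur _ (sub_incl_in _ w)) as [b hb].
    assert (hb' : W P (q b)) by (rewrite hb; apply (sub_incl_in (W_sub P))).
    destruct (sub_lift (subgroup_preimage B A q (W P) hq (W_sub P)) b hb') as [x hx].
    exists x; apply sub_incl_inj; rewrite <- hb, <- hx; reflexivity.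
Qed.

(** The exponent of [t] is a homomorphism onto the integers. Its kernel is the directed union of the
    groups [preW] over the finite subsets of [P], so it lies one step above omega and the whole
    group two. *)
Lemma cover_EG (P : idx -> Prop) : shift_stable P ->
  (forall x y, q x = gone -> q y = gone -> x ** y = y ** x) ->
  (forall w, W P w -> exists b, q b = w) -> (exists b, q b = t) -> (forall b, nf P (q b)) ->
  EGomega 2 B.
Proof.
  intros hst hab hsur [b0 hb0] hnf.
  assert (hex : forall b, exists k : int_group, exists w, W P w /\ q b = w ** zpow t k).
  { intros b; destruct (hnf b) as (w & k & h); exists k, w; auto. }
  apply (choice (fun b (k : int_group) => exists w, W P w /\ q b = w ** zpow t k))
    in hex as [p hp].
  assert (hu : forall b k w, W P w -> q b = w ** zpow t k -> p b = k).
  { intros b k w hw e; destruct (hp b) as (v & hv & e').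
    apply (nf_unique P P v w); auto; congruence. }
  assert (hom : is_hom B int_group p).
  { intros x y; destruct (hp x) as (w & hw & e), (hp y) as (v & hv & e').
    apply (hu _ _ (w ** cj (zpow t (p x)) v)).
    - apply gen_mul; auto; apply conj_tW_stable; auto.
    - rewrite hq, e, e'; unfold cj; change (p x ** p y) with (p x + p y).
      rewrite zpow_add, !gassoc, mul_inv_assoc; reflexivity. }
  left; apply (extension_of_hom _ _ _ p hom).
  - right.
    set (K := kernel_subgroup B int_group p hom).
    assert (hker : forall b, W P (q b) -> p b = gone)
      by (intros b hb; apply (hu b 0 (q b)); auto; symmetry; apply gone_r).
    set (I := {Q : idx -> Prop | fin Q /\ forall l, Q l -> P l}).
    assert (hIK : forall (i : I) (x : preW (proj1_sig i)), p (sub_incl _ x) = gone).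
    { intros [Q [h1 h2]] x; apply hker, (W_mono Q); auto.
      exact (sub_incl_in (subgroup_preimage B A q (W Q) hq (W_sub Q)) x). }
    exists I, (fun i => preW (proj1_sig i)),
      (fun i x => exist _ (sub_incl _ x) (hIK i x) : sub_group K).
    assert (hle : forall i j : I, (forall l, proj1_sig i l -> proj1_sig j l) ->
      forall x : preW (proj1_sig i), exists y : preW (proj1_sig j),
        (exist _ (sub_incl _ y) (hIK j y) : sub_group K) = exist _ (sub_incl _ x) (hIK i x)).
    { intros i j hij x.
      assert (hx : W (proj1_sig j) (q (sub_incl _ x))).
      { apply (W_mono (proj1_sig i)); auto.
        exact (sub_incl_in (subgroup_preimage B A q _ hq (W_sub (proj1_sig i))) x). }
      destruct (sub_lift (subgroup_preimage B A q _ hq (W_sub (proj1_sig j))) _ hx)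
        as [y hy]; exists y; apply sig_ext; exact hy. }
    split; [|split; [|split]].
    + intros [Q [h1 h2]]; apply preW_EG; auto; intros w hw; apply hsur.
      apply (W_mono Q); auto.
    + intros i; split.
      * intros x y; apply sig_ext; reflexivity.
      * intros x y e; apply sub_incl_inj; exact (f_equal (sub_incl K) e).
    + intros i j.
      assert (hij : fin (fun l => proj1_sig i l \/ proj1_sig j l)
        /\ forall l, proj1_sig i l \/ proj1_sig j l -> P l).
      { destruct i as [Q [h1 h2]], j as [R [h3 h4]]; simpl.
        split; [apply fin_or; auto|intros l []; auto]. }
      exists (exist (fun Q => fin Q /\ forall l, Q l -> P l) _ hij); split; intros x; apply hle; simpl; auto.
    + intros g; destruct (hp (sub_incl K g)) as (w & hw & e).
      rewrite (sub_incl_in K g : p _ = 0) in e; simpl in e; rewrite gone_r in e.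
      destruct (W_fin P w hw) as [Q [h1 [h2 h3]]]; rewrite <- e in h3.
      exists (exist (fun Q => fin Q /\ forall l, Q l -> P l) Q (conj h1 h2)).
      destruct (sub_lift (subgroup_preimage B A q _ hq (W_sub Q)) _ h3) as [y hy].
      exists y; apply sig_ext; exact hy.
  - apply EGstep_incl; exists 0%nat; right; intros x y; simpl; lia.
  - intros k; exists (zpow b0 k).
    apply (hu _ _ gone); [apply gen_one|].
    rewrite (hom_zpow B A q), hb0, gone_l; auto.
Qed.

End Cover.

(** ** Lower bounds on the EA-class *)

Definition rng (i : Z) (m : nat) (l : idx) : Prop :=
  inner l /\ i <= snd l < i + Z.of_nat m.

Lemma rng_fin i m : fin (rng i m).
Proof.
  exists (map (fun k => (false, i + Z.of_nat k)) (seq 0 m)).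
  intros [b j] [h1 h2]; unfold inner in h1; simpl in *; subst b.
  apply in_map_iff; exists (Z.to_nat (j - i)); split; [f_equal; lia|].
  apply in_seq; lia.
Qed.

(** [section K P r] says that [r] is the graph of a homomorphism from a subgroup of [K] onto
    [W P]. *)
Record section (K : group) (P : idx -> Prop) (r : K -> A -> Prop) : Prop := {
  sec_one : r gone gone;
  sec_mul : forall x y a b, r x a -> r y b -> r (x ** y) (a ** b);
  sec_inv : forall x a, r x a -> r (inv x) (inv a);
  sec_fun : forall a, r gone a -> a = gone;
  sec_W : forall x a, r x a -> W P a;
  sec_f : forall l, P l -> exists x, r x (f l)
}.

Lemma sec_sur K P r a : section K P r -> W P a -> exists x, r x a.
Proof.
  intros hr; induction 1 as [|a [l [hl ->]]|a _ [x hx]|a b _ [x hx] _ [y hy]].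
  - exists gone; apply hr.
  - apply hr; auto.
  - exists (inv x); apply hr; auto.
  - exists (x ** y); apply hr; auto.
Qed.

Lemma sec_fun2 K P r x a b : section K P r -> r x a -> r x b -> a = b.
Proof.
  intros hr ha hb; apply (mul_cancel_r A (inv b)); rewrite mul_inv.
  apply hr; rewrite <- (mul_inv K x); apply hr; auto; apply hr; auto.
Qed.

Definition has_section (K : group) (i : Z) (m : nat) : Prop :=
  exists r, section K (rng i m) r.

Lemma sec_npow K P r x a n : section K P r -> r x a -> r (npow x n) (npow a n).
Proof.
  intros hr hx; induction n; simpl; apply hr; auto.
Qed.

Lemma npow_f_inj l m n : npow (f l) m = npow (f l) n -> m = n.
Proof.
  rewrite <- !zpow_of_nat; intros e.
  pose proof (proj1 (fpow_o l (Z.of_nat m))) as e1.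
  rewrite e, (proj1 (fpow_o l (Z.of_nat n))) in e1; lia.
Qed.

(** A chain of length two excludes both cases: the powers of [f (false, i)] are distinct, which
    rules out a finite group, and two consecutive generators do not commute, as their products
    differ at [o]. *)
Lemma section_EG0 K i m : EG0 K -> has_section K i m -> (m < 2)%nat.
Proof.
  intros hK [r hr]; apply NNPP; intros hm.
  assert (h0 : rng i m (false, i)) by (split; [reflexivity|simpl; lia]).
  assert (h1 : rng i m (false, i + 1)) by (split; [reflexivity|simpl; lia]).
  destruct (sec_f _ _ _ hr _ h0) as [x hx], (sec_f _ _ _ hr _ h1) as [y hy].
  destruct hK as [[ls hls]|hab].
  - assert (hnd : NoDup (map (npow x) (seq 0 (S (length ls))))).
    { apply FinFun.Injective_map_NoDup; [|apply seq_NoDup].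
      intros a b e; apply (npow_f_inj (false, i)).
      apply (sec_fun2 K (rng i m) r (npow x a)); auto; [|rewrite e];
        apply (sec_npow K (rng i m)); auto. }
    apply (NoDup_incl_length (l' := ls)) in hnd; [|intros z _; apply hls].
    rewrite length_map, length_seq in hnd; lia.
  - specialize (hab x y).
    assert (e : f (false, i) ** f (false, i + 1) = f (false, i + 1) ** f (false, i)).
    { apply (sec_fun2 K (rng i m) r (x ** y)); auto; [|rewrite hab]; apply hr; auto. }
    apply (f_equal (fun a => co (act a o) (false, i))) in e.
    rewrite !(act_mul H), (f_diff H (false, i + 1)), f_one_o in e by (intros e'; injection e'; lia).
    rewrite (f_off H) in e.
    + rewrite (f_diff H), (co_o H) in e by (intros e'; injection e'; lia); discriminate.
    + intros u; specialize (u (false, i + 1)); rewrite f_one_o in u.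
      discriminate u; unfold ilt; simpl; lia.
Qed.

(** Lifts of the finitely many generators already lie in a single member of the directed family. *)
Lemma section_union (P : group -> Prop) K i m :
  (forall K', P K' -> has_section K' i m -> False) ->
  is_directed_union P K -> has_section K i m -> False.
Proof.
  intros hP (I & Hi & j & hPi & hj & hdir & hcov) [r hr].
  assert (hex : forall n, (n <= m)%nat -> exists k, forall l, rng i n l ->
    exists x, r (j k x) (f l)).
  { induction n as [|n IH]; intros hn.
    - destruct (hcov gone) as (k & _); exists k; intros l [_ hl]; simpl in hl; lia.
    - destruct (IH ltac:(lia)) as [k hk].
      assert (hin : rng i m (false, i + Z.of_nat n)) by (split; [reflexivity|simpl; lia]).
      destruct (sec_f _ _ _ hr _ hin) as [x hx].
      destruct (hcov x) as (k' & x' & e), (hdir k k') as (k2 & h1 & h2).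
      exists k2; intros [b l] [hb hl]; unfold inner in hb; simpl in *; subst b.
      destruct (Z.eq_dec l (i + Z.of_nat n)) as [->|ne].
      + destruct (h2 x') as [y hy]; exists y; rewrite hy, e; auto.
      + destruct (hk (false, l)) as [z hz]; [split; [reflexivity|simpl; lia]|].
        destruct (h1 z) as [y hy]; exists y; rewrite hy; auto. }
  destruct (hex m (Nat.le_refl m)) as [k hk].
  apply (hP (Hi k) (hPi k)).
  destruct (hj k) as [hom _].
  exists (fun x a => r (j k x) a); split.
  - rewrite hom_one by auto; apply hr.
  - intros; rewrite hom; apply hr; auto.
  - intros; rewrite hom_inv by auto; apply hr; auto.
  - intros a; rewrite hom_one by auto; apply hr.
  - intros x a; apply hr.
  - auto.
Qed.

(** The word sets the coordinates from [l] upward, lowest first: a generator acts only while all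
    higher coordinates vanish, so each coordinate is set before the ones above it. *)
Lemma reach i m l x : i <= l < i + Z.of_nat m ->
  (forall u, ilt (false, l) u -> ~ rng i m u -> co x u = 0) ->
  exists h, W (rng i m) h /\ forall u, ~ ilt u (false, l) -> co (act h o) u = co x u.
Proof.
  intros hl hx.
  (* Induction downward from the end of the range; [d] is the number of indices of the range from
     [k] on. *)
  assert (hex : forall d k, k = i + Z.of_nat m - Z.of_nat d -> l <= k -> exists h,
    W (fun u => rng i m u /\ k <= snd u) h
    /\ forall u, ~ ilt u (false, k) -> co (act h o) u = co x u).
  { induction d as [|d IH]; intros k -> hk.
    - exists gone; split; [apply gen_one|]; intros u hu.
      rewrite (act_one H), (co_o H); symmetry; apply hx.
      + clear - hl hu; idx_tac.
      + clear - hk hu; unfold rng; idx_tac.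
    - destruct (IH _ eq_refl ltac:(lia)) as [h [hW hh]].
      set (k := i + Z.of_nat m - Z.of_nat (S d)) in *.
      set (n := (false, k)).
      exists (h ** zpow (f n) (co x n)); split.
      + apply gen_mul.
        * revert hW; apply W_mono; intros u [? ?]; split; auto; lia.
        * apply sub_zpow; [apply W_sub|apply W_f]; repeat split; simpl; lia.
      + destruct (fpow_o n (co x n)) as [e1 e2].
        intros u hu; rewrite (act_mul H).
        destruct (classic (u = n)) as [->|ne].
        * rewrite (W_out _ _ _ _ hW), e1; auto; intros [_ hs]; unfold n in hs; simpl in hs; lia.
        * assert (hnu : ilt n u) by (destruct (ilt_total n u) as [?|[->|?]]; tauto).
          rewrite (W_agree _ h (ilt n) _ o hW) with (m := u); auto.
          -- apply hh; unfold n in *; clear - hnu hk; subst k; idx_tac.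
          -- intros a b; apply ilt_trans.
          -- intros u' hu'; rewrite e2, (co_o H); auto.
             intros ->; exact (ilt_irrefl _ hu'). }
  destruct (hex (Z.to_nat (i + Z.of_nat m - l)) l) as [h [hW hh]]; [lia|lia|].
  exists h; split; auto; revert hW; apply W_mono; intros u []; auto.
Qed.

(** Kernel elements act trivially on the coordinates from [i + B] up, so restricting the section to
    these coordinates makes it factor through [Q]. *)
Lemma section_quotient (K Q : group) (p : K -> Q) r i m B : section K (rng i m) r ->
  is_hom K Q p -> (B <= m)%nat ->
  (forall x a, p x = gone -> r x a -> forall y l, ~ ilt l (false, i + Z.of_nat B) ->
    co (act a y) l = co y l) ->
  has_section Q (i + Z.of_nat B) (m - B).
Proof.
  intros hr hp hB htriv.
  set (j := i + Z.of_nat B) in *.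
  set (U := fun l => ~ ilt l (false, j)).
  assert (hU : upset U).
  { intros a b h1 h2 h3; apply h1, (ilt_trans _ b); auto. }
  assert (hmono : forall a, W (rng j (m - B)) a -> W (rng i m) a).
  { intros a; apply W_mono; intros l [h1 h2]; split; auto; subst j; lia. }
  exists (fun y a' => exists x a, p x = y /\ r x a /\ W (rng j (m - B)) a'
    /\ forall z l, U l -> co (act a' z) l = co (act a z) l).
  split.
  - exists gone, gone; split; [apply hom_one; auto|]; split; [apply hr|].
    split; [apply gen_one|auto].
  - intros y1 y2 a1' a2' (x1 & a1 & e1 & r1 & w1 & h1) (x2 & a2 & e2 & r2 & w2 & h2).
    exists (x1 ** x2), (a1 ** a2); split; [rewrite hp, e1, e2; auto|].
    split; [apply hr; auto|]; split; [apply gen_mul; auto|].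
    intros z l hl; rewrite !(act_mul H), h1 by auto.
    apply (W_agree (rng i m) _ U); auto; apply (sec_W _ _ _ hr x1); auto.
  - intros y a' (x & a & e & ra & w & h).
    exists (inv x), (inv a); split; [rewrite hom_inv, e by auto; auto|].
    split; [apply hr; auto|]; split; [apply gen_inv; auto|].
    intros z l hl.
    rewrite <- (act_Vl a (act (inv a') z)).
    assert (wa : W (rng i m) (inv a)) by (apply gen_inv, (sec_W _ _ _ hr x); auto).
    apply (W_agree _ _ U _ _ wa); auto.
    intros u hu; rewrite <- h, act_Vr by auto; auto.
  - intros a' (x & a & e & ra & w & h).
    apply (W_trivial (rng j (m - B))); auto.
    intros z; apply (co_inj H); intros l.
    destruct (classic (U l)) as [u|u].
    + rewrite h by auto; apply (htriv x); auto.
    + apply (W_out (rng j (m - B))); auto; intros [hl1 hl2]; apply u.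
      clear - hl1 hl2; subst U j; idx_tac.
  - intros y a' (x & a & e & ra & w & h); auto.
  - intros l hl.
    assert (hl' : rng i m l) by (destruct hl; split; auto; subst j; lia).
    destruct (sec_f _ _ _ hr l hl') as [x hx].
    exists (p x), x, (f l); repeat split; auto; apply W_f; auto.
Qed.

(** The commutators of an element moving coordinate [l] with elements of the section supported in a
    cylinder it displaces recover, on that cylinder, all of [W (rng i (l - i))]. *)
Lemma section_kernel (K N : group) (e : N -> K) r i m n a l x : section K (rng i m) r ->
  is_hom N K e -> (forall y g, exists n', e n' = g ** e y ** inv g) ->
  r (e n) a -> co (act a x) (false, l) <> co x (false, l) ->
  (forall u, ilt (false, l) u -> co (act a x) u = co x u) ->
  has_section N i (Z.to_nat (l - i)).
Proof.
  intros hr he hnorm ra hmov hup.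
  assert (wa : W (rng i m) a) by (apply (sec_W _ _ _ hr (e n)); auto).
  assert (hrl : rng i m (false, l)) by (apply NNPP; intros hn; apply hmov, (W_out (rng i m)); auto).
  assert (hl : i <= l < i + Z.of_nat m) by apply hrl.
  destruct (reach i m l x hl) as [h [wh hh]].
  { intros u hu hn; apply NNPP; intros hne; apply hmov, (W_below (rng i m) a u); auto. }
  set (P := rng i (Z.to_nat (l - i))).
  assert (hPlt : forall u, P u -> ilt u (false, l)).
  { intros u [h1 h2]; unfold ilt; rewrite h1; simpl; lia. }
  assert (hPr : forall u, P u -> rng i m u).
  { intros u [h1 h2]; split; auto; lia. }
  (* [C] is the cylinder of points whose coordinates from [l] up vanish. The element [h] carries it
     to points that agree with [x] on those coordinates, and [a] displaces these, changing their
     coordinate [l]. *)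
  set (C := fun y => forall u, ~ ilt u (false, l) -> co y u = 0).
  assert (hC : forall b y, W P b -> C y -> C (act b y)).
  { intros b y hb hy u hu; rewrite (W_out P); auto. }
  assert (hge : upset (fun u => ~ ilt u (false, l)))
    by (intros u v h1 h2 h3; apply h1, (ilt_trans _ v); auto).
  assert (hhC : forall y, C y -> forall u, ~ ilt u (false, l) -> co (act h y) u = co x u).
  { intros y hy u hu; rewrite <- hh by auto.
    apply (W_agree (rng i m) h (fun u => ~ ilt u (false, l))); auto.
    intros v hv; rewrite hy, (co_o H); auto. }
  (* Here [n'] is related to [b] when an element corresponding to its image acts on the translated
     cylinder as the conjugate of [b] by [h]. *)
  exists (fun n' b => W P b /\ exists a', r (e n') a' /\
    forall y, C y -> act a' (act h y) = act h (act b y)).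
  split.
  - split; [apply gen_one|]; exists gone; rewrite hom_one by auto; split; [apply hr|].
    intros; rewrite !(act_one H); auto.
  - intros n1 n2 b1 b2 [w1 (a1 & r1 & h1)] [w2 (a2 & r2 & h2)].
    split; [apply gen_mul; auto|].
    exists (a1 ** a2); rewrite he; split; [apply hr; auto|].
    intros y hy; rewrite !(act_mul H), h2, h1; auto.
  - intros n1 b1 [w1 (a1 & r1 & h1)]; split; [apply gen_inv; auto|].
    exists (inv a1); rewrite hom_inv by auto; split; [apply hr; auto|].
    intros y hy.
    assert (hy' : C (act (inv b1) y)) by (apply hC; auto; apply gen_inv; auto).
    specialize (h1 _ hy'); rewrite act_Vr in h1; rewrite <- h1, act_Vl; auto.
  - intros b [wb (a' & ra' & hb)].
    rewrite hom_one in ra' by auto; apply (sec_fun _ _ _ hr) in ra'; subst a'.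
    apply (W_trivial P); auto; intros y.
    destruct (classic (C y)) as [hy|hy].
    + specialize (hb y hy); rewrite (act_one H) in hb.
      rewrite <- (act_Vl h (act b y)), <- hb, act_Vl; auto.
    + apply not_all_ex_not in hy as [u hu]; apply imply_to_and in hu as [hu1 hu2].
      assert (hPu : ~ P u) by (intros hPu; apply hu1; auto).
      apply (co_inj H); intros v; destruct (classic (P v)) as [hv|hv].
      * apply (W_below P b u); auto.
        destruct (ilt_total v u) as [?|[->|huv]]; auto; [tauto|].
        destruct hu1; apply (ilt_trans _ v); auto.
      * apply (W_out P); auto.
  - intros n' b []; auto.
  - intros v hv.
    set (s := h ** inv (f v) ** inv h).
    assert (ws : W (rng i m) s)
      by (repeat apply gen_mul; auto; apply gen_inv; [apply W_f|]; auto).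
    destruct (sec_sur _ _ _ _ hr ws) as [k hk].
    destruct (hnorm n k) as [n1 hn1].
    exists (inv n ** n1); split; [apply W_f; auto|].
    (* On the translated cylinder [inv s] acts as the conjugate of [f v] by [h]; then [a] leaves the
       cylinder, [s] fixes the resulting point, and [inv a] returns. *)
    exists (inv a ** (s ** a ** inv s)); split.
    + rewrite he, hom_inv, hn1 by auto; repeat apply hr; auto.
    + intros y hy; rewrite !(act_mul H).
      assert (es : act (inv s) (act h y) = act h (act (f v) y))
        by (unfold s; rewrite !inv_prod, !inv_inv, !(act_mul H), act_Vl; auto).
      rewrite es; set (x' := act h (act (f v) y)).
      assert (hx' : forall u, ~ ilt u (false, l) -> co x' u = co x u)
        by (apply hhC, hC; auto; apply W_f; auto).
      assert (e' : act s (act a x') = act a x'); [|rewrite e', act_Vl; auto].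
      unfold s; rewrite !(act_mul H), fV_off, act_Vr; auto.
      intros u0; apply hmov.
      assert (hCz : C (act (inv h) (act a x'))).
      { intros u hu; apply u0; destruct (ilt_total v u) as [?|[->|?]]; auto;
        destruct hu; [|apply (ilt_trans _ v)]; auto. }
      rewrite <- (hhC _ hCz) by apply ilt_irrefl; rewrite act_Vr.
      apply (W_agree (rng i m) a (fun u => ~ ilt u (false, l))); auto.
      intros u hu; symmetry; auto.
Qed.

Lemma section_bound k : forall K, EGfin k K -> forall i m, has_section K i m ->
  (m < 2 ^ S k)%nat.
Proof.
  induction k as [|k IH]; intros K hK i m hs.
  - apply (section_EG0 K i m); auto.
  - apply NNPP; intros hm.
    assert (hpow : (2 ^ S (S k) = 2 ^ S k + 2 ^ S k)%nat) by (simpl; lia).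
    set (B := (2 ^ S k)%nat) in *.
    destruct hK as [(N & Q & e & p & hN & hQ & he & hei & hp & hps & hex)|hK].
    2: { apply (section_union _ K i m) in hK; auto.
         intros K' hK' hs'; specialize (IH K' hK' i m hs'); lia. }
    destruct hs as [r hr].
    (* Either all kernel elements fix the coordinates from [i + B] on, and the upper half of the
       chain passes to [Q], or one of them moves such a coordinate. *)
    destruct (classic (forall x a, p x = gone -> r x a -> forall y l,
      ~ ilt l (false, i + Z.of_nat B) -> co (act a y) l = co y l)) as [ht|hn].
    + pose proof (IH Q hQ _ _ (section_quotient K Q p r i m B hr hp ltac:(lia) ht)); lia.
    + apply not_all_ex_not in hn as [x0 hn]; apply not_all_ex_not in hn as [a hn].
      apply imply_to_and in hn as [hx0 hn]; apply imply_to_and in hn as [ra hn].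
      apply not_all_ex_not in hn as [x hn]; apply not_all_ex_not in hn as [l0 hn].
      apply imply_to_and in hn as [hl0 hn].
      apply hex in hx0 as [n <-].
      pose proof (sec_W _ _ _ hr _ _ ra) as wa.
      set (S := fun l => co (act a x) l <> co x l).
      assert (hS : forall l, S l -> rng i m l)
        by (intros l hl; apply NNPP; intros hno; apply hl, (W_out (rng i m)); auto).
      (* The largest coordinate changed at [x] is at least [i + B], so commutators with the kernel
         element produce a chain of length at least [B] in [N], against the induction hypothesis. *)
      destruct (max_exists S) as [l [hl hmax]].
      * destruct (rng_fin i m) as [ls hls]; exists ls; auto.
      * exists l0; exact hn.
      * specialize (hmax l0 hn) as hl0'.
        destruct (hS l hl) as [hb hlr]; destruct l as [b l]; unfold inner in hb; simpl in hb.
        subst b; simpl in hlr.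
        assert (hlB : i + Z.of_nat B <= l)
          by (clear - hl0' hl0; idx_tac).
        assert (hsN : has_section N i (Z.to_nat (l - i))).
        { apply (section_kernel K N e r i m n a l x); auto.
          - intros y g; apply hex; rewrite !hp, hom_inv by auto.
            replace (p (e y)) with (@gone Q) by (symmetry; apply hex; eauto).
            rewrite gone_r; apply mul_inv.
          - intros u hu; apply NNPP; intros hne; exact (hmax u hne hu). }
        specialize (IH N hN i _ hsN); lia.
Qed.

(** Arbitrarily long chains exclude all finite levels, hence level omega. At level omega + 1, an
    extension of two groups of finite level again has finite level, and a finitely generated
    directed union equals one of its members. *)
Lemma fg_not_EG (K : group) : finitely_generated K -> (forall m, has_section K 0 m) ->
  forall b, idx_lt b (OmegaPlus 2) -> ~ EG b K.
Proof.
  intros [ls hls] hsec.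
  assert (hfin : forall k, ~ EGfin k K).
  { intros k hk; specialize (section_bound k K hk 0 _ (hsec (2 ^ S k)%nat)); lia. }
  intros [n|[|[|n]]] hlt; simpl in *; try lia.
  - auto.
  - intros [k hk]; exact (hfin k hk).
  - intros [(N & Q & e & p & [k1 hN] & [k2 hQ] & hrest)|(I & Hi & j & hP & hj & hdir & hcov)].
    + apply (hfin (S (k1 + k2))); left; exists N, Q, e, p.
      split; [apply (EGfin_le k1); auto; lia|]; split; [apply (EGfin_le k2); auto; lia|auto].
    + assert (hex : exists k, forall g, In g ls -> exists x, j k x = g).
      { clear hls; induction ls as [|g l [k IH]].
        - destruct (hcov gone) as (k & _); exists k; intros g [].
        - destruct (hcov g) as (k' & x & <-), (hdir k k') as (k2 & h1 & h2); exists k2.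
          intros g' [<-|hg]; [auto|]; destruct (IH g' hg) as [y <-]; auto. }
      destruct hex as [k hk], (hP k) as [n hn], (hj k) as [hom hinj].
      assert (hall : forall g, exists x, j k x = g).
      { intros g; specialize (gen_of_in_gen K ls g (hls g)) as hg.
        induction hg as [|g hg|g _ [x <-]|g g' _ [x <-] _ [y <-]]; auto.
        - exists gone; apply hom_one; auto.
        - exists (inv x); apply hom_inv; auto.
        - exists (x ** y); apply hom. }
      assert (hs : has_section (Hi k) 0 (2 ^ S n)).
      { destruct (hsec (2 ^ S n)%nat) as [r hr].
        exists (fun x a => r (j k x) a); split.
        - rewrite hom_one by auto; apply hr.
        - intros; rewrite hom; apply hr; auto.
        - intros; rewrite hom_inv by auto; apply hr; auto.
        - intros a; rewrite hom_one by auto; apply hr.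
        - intros x a; apply hr.
        - intros l hl; destruct (sec_f _ _ _ hr l hl) as [g hg], (hall g) as [x <-]; eauto. }
      specialize (section_bound n _ hn 0 _ hs); lia.
Qed.

(** ** Obstructions to embeddings *)

Lemma W_fin2 P a b : W P a -> W P b ->
  exists Q, fin Q /\ (forall l, Q l -> P l) /\ W Q a /\ W Q b.
Proof.
  intros ha hb; destruct (W_fin P a ha) as (Q & h1 & h2 & h3).
  destruct (W_fin P b hb) as (R & h4 & h5 & h6).
  exists (fun l => Q l \/ R l); split; [apply fin_or; auto|]; split; [intros l []; auto|].
  split; [apply (W_mono Q)|apply (W_mono R)]; auto.
Qed.

Lemma W_fin_list P (ls : list A) : (forall a, In a ls -> W P a) ->
  exists Q, fin Q /\ forall a, In a ls -> W Q a.
Proof.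
  induction ls as [|a ls IH]; intros h.
  - exists (fun _ => False); split; [exists nil; auto|intros a []].
  - destruct IH as (Q & h1 & h2); [intros; apply h; right; auto|].
    destruct (W_fin P a (h a (or_introl eq_refl))) as (R & h3 & _ & h4).
    exists (fun l => Q l \/ R l); split; [apply fin_or; auto|].
    intros b [<-|hb]; [apply (W_mono R)|apply (W_mono Q)]; auto.
Qed.

(** If [e z] is outside [W], commutators lie in [W] and commute with it, so they vanish and [B] is
    abelian. If [e z] is in [W] but some generator is mapped outside, then [e z] is trivial. If all
    generators are mapped into [W], finitely many indices suffice for the image, which then has
    finite level. *)
Lemma central_not_embeds (B : group) (z : B) : finitely_generated B ->
  (forall m, has_section B 0 m) -> z <> gone -> (forall b, z ** b = b ** z) ->
  ~ embeds B A.
Proof.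
  intros [ls hls] hsec hz hcen (e & he & hinj).
  assert (hker : forall b, e b = gone -> b = gone)
    by (intros b hb; apply hinj; rewrite hb; symmetry; apply hom_one; auto).
  destruct (classic (W (fun _ => True) (e z))) as [hW|hW].
  - destruct (classic (forall b, In b ls -> W (fun _ => True) (e b))) as [hall|hno].
    + destruct (W_fin_list (fun _ => True) (map e ls)) as (P & [ps hP] & hPls).
      { intros a ha; apply in_map_iff in ha as (b & <- & hb); auto. }
      assert (hB : forall b, W P (e b)).
      { intros b; specialize (gen_of_in_gen B ls b (hls b)) as hb.
        induction hb as [|b hb|b _ IH|b c _ IH _ IH'].
        - rewrite hom_one by auto; apply gen_one.
        - apply hPls, in_map; auto.
        - rewrite hom_inv by auto; apply gen_inv; auto.
        - rewrite he; apply gen_mul; auto. }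
      set (n := length ps).
      assert (hs : has_section (sub_group (W_sub P)) 0 (2 ^ S n)).
      { destruct (hsec (2 ^ S n)%nat) as [r hr].
        exists (fun w a => exists b, e b = sub_incl _ w /\ r b a); split.
        - exists gone; split; [apply hom_one; auto|apply hr].
        - intros x y a b (x' & h1 & h2) (y' & h3 & h4); exists (x' ** y').
          split; [rewrite he, h1, h3; reflexivity|apply hr; auto].
        - intros x a (x' & h1 & h2); exists (inv x').
          split; [rewrite hom_inv, h1 by auto; symmetry; apply hom_inv, sub_incl_hom|].
          apply hr; auto.
        - intros a (x' & h1 & h2); apply hker in h1; subst x'; apply hr; auto.
        - intros x a (x' & h1 & h2); apply (sec_W _ _ _ hr x'); auto.
        - intros l hl; destruct (sec_f _ _ _ hr l hl) as [b hb].
          destruct (sub_lift (W_sub P) (e b) (hB b)) as [w hw]; exists w, b; auto. }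
      pose proof (section_bound n _ (W_EG n P ps (Nat.le_refl _) hP) 0 _ hs); lia.
    + apply not_all_ex_not in hno as [s hs]; apply imply_to_and in hs as [_ hs].
      apply hz, hker, (centralizer_trivial (fun _ => True) (e s)); auto.
      rewrite <- !he, hcen; auto.
  - assert (hab : is_abelian B).
    { intros x y.
      assert (h : x ** y ** inv x ** inv y = gone).
      { apply hker, (centralizer_trivial (fun _ => True) (e z)); auto.
        - rewrite hom_commutator by auto; apply commutator_W.
        - rewrite <- !he, hcen; auto. }
      apply commutator_one; auto. }
    pose proof (section_bound 0 B (or_intror hab) 0 _ (hsec 2%nat)) as hb; simpl in hb; lia.
Qed.

(** The part of the space on which the inner generators act. *)
Definition Z0 (x : X) : Prop := forall i, co x (true, i) = 0.

Lemma inner_stable : shift_stable inner.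
Proof. intros k l; auto. Qed.

Lemma inner_off a x : W inner a -> ~ Z0 x -> act a x = x.
Proof.
  intros ha hx; apply not_all_ex_not in hx as [i hi]; apply (co_inj H); intros [[] j].
  - apply (W_out inner); auto; discriminate.
  - apply (W_below inner a (true, i)); auto; [discriminate|exact I].
Qed.

(** Inner generators leave the outer coordinates alone, and [t] only permutes them. *)
Lemma Z0_nf a x : nf inner a -> Z0 (act a x) <-> Z0 x.
Proof.
  intros (w & k & hw & ->); rewrite (act_mul H).
  assert (e : forall i, co (act w (act (zpow t k) x)) (true, i) = co x (true, i - k)).
  { intros i; rewrite (W_out inner); auto; [|discriminate].
    rewrite <- (tpow_co k x (true, i - k)); f_equal; unfold shift; simpl; f_equal; lia. }
  split; intros h i; [|rewrite e; auto].
  specialize (h (i + k)); rewrite e in h; rewrite <- h; do 2 f_equal; lia.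
Qed.

(** Inner elements move only points of [Z0], and their conjugates by [y] only points of the
    translate of [Z0], which is disjoint from it. *)
Lemma disjoint_commute x x' y : W inner x -> W inner x' ->
  (forall z, Z0 z -> ~ Z0 (act y z)) -> x ** cj y x' = cj y x' ** x.
Proof.
  intros hx hx' hy.
  assert (hxT : W (fun _ => True) x) by (apply (W_mono inner); auto).
  assert (hcT : W (fun _ => True) (cj y x')) by (apply conj_W_all, (W_mono inner); auto).
  apply (W_eq (fun _ => True) (fun _ => True)); try (apply gen_mul; auto).
  assert (hyV : forall z, Z0 z -> ~ Z0 (act (inv y) z))
    by (intros z hz hn; apply (hy _ hn); rewrite act_Vr; auto).
  intros z; rewrite !(act_mul H), !act_conj.
  destruct (classic (Z0 z)) as [hz|hz].
  - rewrite !(inner_off x'), !act_Vr; auto; apply hyV; auto.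
    apply Z0_nf; auto; apply nf_W; auto.
  - rewrite (inner_off x z); auto; apply inner_off; auto.
    destruct (classic (Z0 (act (inv y) z))) as [h|h].
    + apply hy, Z0_nf; auto; apply nf_W; auto.
    + rewrite (inner_off x'), act_Vr; auto.
Qed.

Lemma npow_nf w k n : W inner w ->
  exists v, W inner v /\ npow (w ** zpow t k) n = v ** zpow t (k * Z.of_nat n).
Proof.
  intros hw; induction n as [|n (v & hv & e)].
  - exists gone; split; [apply gen_one|]; rewrite Z.mul_0_r, gone_l; reflexivity.
  - exists (w ** cj (zpow t k) v); split.
    + apply gen_mul; auto; apply conj_tW_stable; auto; apply inner_stable.
    + simpl npow; rewrite e; replace (k * Z.of_nat (S n)) with (k + k * Z.of_nat n) by lia.
      unfold cj; rewrite zpow_add, !gassoc, mul_inv_assoc; reflexivity.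
Qed.

Lemma nf_W_restrict P Q a : nf P a -> W Q a -> W P a.
Proof.
  intros (w & k & hw & e) ha.
  assert (hk : k = 0)
    by (apply (nf_unique P Q w a); auto; rewrite <- e; simpl; symmetry; apply gone_r).
  rewrite e, hk; simpl; rewrite gone_r; auto.
Qed.

(** This is a commutator of the inverse of a generator with [t], so every endomorphism sends it into
    [W]; the generators themselves may be sent elsewhere. *)
Definition fdiff (b : bool) (i : Z) : A := inv (f (b, i)) ** f (b, i + 1).

Lemma hom_fdiff_W (p : A -> A) b i : is_hom A A p -> W (fun _ => True) (p (fdiff b i)).
Proof.
  intros hp.
  replace (fdiff b i) with (inv (f (b, i)) ** t ** inv (inv (f (b, i))) ** inv t).
  - rewrite hom_commutator by auto; apply commutator_W.
  - unfold fdiff; rewrite inv_inv, <- (gassoc _ _ t), (t_f H), gassoc, mul_assoc_inv.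
    reflexivity.
Qed.

Lemma fdiff_inner i : W inner (fdiff false i).
Proof. apply gen_mul; [apply gen_inv|]; apply W_f; reflexivity. Qed.

Lemma fdiff_o i j : j <> i -> co (act (fdiff false i) o) (false, j) =
  if Z.eq_dec j (i + 1) then 1 else 0.
Proof.
  intros h; unfold fdiff; rewrite (act_mul H), fV_diff by (intros e; injection e; auto).
  destruct (Z.eq_dec j (i + 1)) as [->|ne]; [apply f_one_o|].
  rewrite (f_diff H), (co_o H); auto; intros e; injection e; auto.
Qed.

(** At [o], [fdiff false 2] sets coordinate 3 to 1, which blocks the inner generators 0 and 1. So
    coordinate 1 is raised only when [fdiff false 0] is applied first. *)
Lemma fdiff_noncommute : fdiff false 0 ** fdiff false 2 <> fdiff false 2 ** fdiff false 0.
Proof.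
  intros e; apply (f_equal (fun a => co (act a o) (false, 1))) in e.
  rewrite !(act_mul H) in e.
  assert (h : forall x, co (act (fdiff false 2) x) (false, 1) = co x (false, 1)).
  { intros x; unfold fdiff; rewrite (act_mul H), fV_diff, (f_diff H); auto;
    intros e'; discriminate e'. }
  rewrite h, (fdiff_o 0 1) in e by lia.
  set (x := act (fdiff false 2) o) in *.
  assert (hx : co x (false, 3) = 1) by (unfold x; rewrite fdiff_o; [reflexivity|lia]).
  assert (e0 : act (fdiff false 0) x = x).
  { assert (hoff : forall j, j < 3 -> ~ up0 (false, j) x)
      by (intros j hj u; rewrite u in hx; [discriminate|exact hj]).
    unfold fdiff; rewrite (act_mul H), (f_off H), fV_off; auto; apply hoff; lia. }
  rewrite e0 in e; unfold x in e; rewrite h, (co_o H) in e; simpl in e; discriminate.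
Qed.

(** If [y] pushes [Z0] off itself then so do its conjugates by powers of [s], so they make
    [fdiff false 0] and a conjugate of [fdiff false 2] commute; when [p s] contracts the index set,
    these conjugations act trivially on any prescribed final segment of coordinates. *)
Lemma contraction_commutes (p : A -> A) s : is_hom A A p -> (forall a, nf inner (p a)) ->
  nf inner s -> (exists w k, W inner w /\ p s = w ** zpow t k /\ k < 0) ->
  p (fdiff false 0) ** p (fdiff false 2) = p (fdiff false 2) ** p (fdiff false 0).
Proof.
  intros hp hnf hs (w & k & hw & ew & hk).
  set (x := fdiff false 0); set (x' := fdiff false 2); set (y := inv (fdiff true 0)).
  assert (hW : forall b i, W inner (p (fdiff b i)))
    by (intros b i; apply (nf_W_restrict _ (fun _ => True)); auto; apply hom_fdiff_W; auto).
  destruct (W_fin2 inner (p x) (p x')) as (P & hP & hPi & hx & hx'); try apply hW.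
  destruct (low_inner P hP) as [i0 hi0].
  set (U := fun l => ilt (false, i0) l).
  assert (hU : upset U) by (intros a b; apply ilt_trans).
  assert (hPU : forall l, P l -> U l).
  { intros [b j] hl; pose proof (hPi _ hl) as hb; unfold inner in hb; simpl in hb; subst b.
    unfold U, ilt; simpl; apply Z.nle_gt; intros hj; exact (hi0 j hj hl). }
  assert (hy : W inner (p y)) by (unfold y; rewrite hom_inv by auto; apply gen_inv, hW).
  (* Each conjugation by [p s] lowers the top level [l0] of [p y] by at least one, so [l0 - i0] of
     them bring it to [i0] or lower, outside [U]. *)
  assert (hn : exists n, forall z l, U l -> co (act (cj (npow (p s) n) (p y)) z) l = co z l).
  { destruct (classic (p y = gone)) as [e|ne].
    - exists 0%nat; intros z l _; rewrite e, conj_one, (act_one H); auto.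
    - destruct (top_exists inner _ hy ne) as [[b l0] [htop hb]].
      unfold inner in hb; simpl in hb; subst b.
      exists (Z.to_nat (l0 - i0)); intros z l hl.
      destruct (npow_nf w k (Z.to_nat (l0 - i0)) hw) as (v & hv & e).
      rewrite ew, e; apply not_moves.
      apply (top_conj inner _ v (k * Z.of_nat (Z.to_nat (l0 - i0))) _ hv) in htop.
      apply htop; unfold U, ilt, shift in *; destruct l as [[] l]; simpl in *; auto.
      nia. }
  destruct hn as [n hn].
  set (v := cj (npow (p s) n) (p y)) in *.
  assert (hc : x ** cj (cj (npow s n) y) x' = cj (cj (npow s n) y) x' ** x).
  { apply disjoint_commute; try apply fdiff_inner.
    assert (hsn : nf inner (npow s n))
      by (apply sub_npow; auto; apply nf_subgroup, inner_stable).
    assert (hsV : nf inner (inv (npow s n)))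
      by (apply (sub_inv _ (nf_subgroup _ inner_stable)); auto).
    intros z hz; rewrite act_conj, Z0_nf by auto.
    rewrite <- (Z0_nf _ z hsV) in hz; set (z' := act (inv (npow s n)) z) in *.
    (* On [Z0], [y] raises coordinate [(true, 0)] from 0 to 1. *)
    intros h; specialize (h 0); revert h.
    unfold y, fdiff; rewrite inv_prod, inv_inv.
    assert (e : forall z, co (act (inv (f (true, 0 + 1)) ** f (true, 0)) z) (true, 0)
      = co (act (f (true, 0)) z) (true, 0))
      by (intros; rewrite (act_mul H), fV_diff; auto; intros e; discriminate e).
    rewrite e, (f_same H), hz; [discriminate|].
    intros [[] j] hj; [apply hz|destruct hj]. }
  assert (hcj : forall a b, p (cj a b) = cj (p a) (p b))
    by (intros a b; unfold cj; rewrite !hp, hom_inv by auto; reflexivity).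
  apply (f_equal p) in hc; rewrite !hp, !hcj, hom_npow in hc by auto.
  change (p x ** cj v (p x') = cj v (p x') ** p x) in hc.
  assert (hvV : forall z l, U l -> co (act (inv v) z) l = co z l)
    by (intros z l hl; rewrite <- (hn (act (inv v) z)) by auto; rewrite act_Vr; auto).
  assert (hcU : forall z l, U l -> co (act (cj v (p x')) z) l = co (act (p x') z) l).
  { intros z l hl; rewrite act_conj, hn by auto.
    apply (W_agree P _ U); auto. }
  (* Both products are words over [P], which is contained in [U]; so it suffices to compare them on
     [U], where the conjugate acts as [p x']. *)
  apply (W_eq P P); try (apply gen_mul; auto).
  intros z; apply (co_inj H); intros l.
  destruct (classic (U l)) as [u|u].
  - apply (f_equal (fun a => co (act a z) l)) in hc; rewrite !(act_mul H) in hc |- *.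
    rewrite hcU in hc by auto; rewrite <- hc.
    apply (W_agree P _ U); auto; intros m hm; symmetry; auto.
  - assert (hl : ~ P l) by auto.
    rewrite !(act_mul H), !(W_out P); auto.
Qed.

(** The last hypothesis on [q] says that it kills no nontrivial commutator: the kernel is central,
    and commutation relations lift from the image to [B]. *)
Lemma cover_not_embeds (B : group) (q : B -> A) : is_hom B A q ->
  (forall b, nf inner (q b)) -> (forall w, W inner w -> exists b, q b = w) ->
  (forall x y, q (x ** y) = q (y ** x) -> x ** y = y ** x) -> ~ embeds A B.
Proof.
  intros hq hnf hsur hcomm (e & he & hinj).
  set (p := fun a => q (e a)).
  assert (hp : is_hom A A p) by (intros a b; unfold p; rewrite he, hq; auto).
  assert (hker : forall a, e a = gone -> a = gone)
    by (intros b hb; apply hinj; rewrite hb; symmetry; apply hom_one; auto).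
  set (g := f (false, 0)).
  assert (hg : nf inner g) by (apply nf_W, W_f; reflexivity).
  (* If [p s] has a nonzero exponent of [t], then [s] or its inverse contracts the index set, and
     the commutation obtained contradicts [fdiff_noncommute]. *)
  assert (hcontra : forall s, nf inner s -> ~ W inner (p s) -> False).
  { intros s hs hs'; apply fdiff_noncommute, hinj; rewrite !he; apply hcomm.
    rewrite !hq; destruct (nf_in_W inner _ hs' (hnf _)) as (w & k & hw & ew & hk).
    destruct (Z_lt_le_dec k 0) as [hk'|hk'].
    - apply (contraction_commutes p s); eauto; intros; apply hnf.
    - apply (contraction_commutes p (inv s)); auto; [intros; apply hnf| |].
      + apply (sub_inv _ (nf_subgroup _ inner_stable)); auto.
      + exists (cj (zpow t (- k)) (inv w)), (- k); split; [|split; [|lia]].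
        * apply conj_tW_stable; [apply inner_stable|apply gen_inv; auto].
        * rewrite hom_inv, ew, inv_prod by auto; unfold cj.
          rewrite mul_inv_assoc, zpow_opp; auto. }
  assert (h1 : W inner (p g)) by (apply NNPP; intros h; apply (hcontra g); auto).
  assert (h2 : W inner (p t)) by (apply NNPP; intros h; apply (hcontra t); auto; apply nf_t).
  destruct (W_fin2 inner _ _ h1 h2) as (P & hP & hPi & w1 & w2).
  destruct (preW_EG q hq P) as [n hn]; auto.
  { intros x y hx hy; apply hcomm; rewrite !hq, hx, hy; auto. }
  { intros w hw; apply hsur, (W_mono P); auto. }
  (* The conjugates of [g] by powers of [t] all map into [W P] with [P] finite. The preimage of
     [W P] has finite level [n], yet it contains chains too long for that level. *)
  assert (hs : has_section (preW q hq P) 0 (2 ^ S n)).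
  { exists (fun b a => e a = sub_incl _ b /\ W (rng 0 (2 ^ S n)) a); split.
    - split; [apply hom_one; auto|apply gen_one].
    - intros x y a b [e1 w3] [e2 w4]; split; [rewrite he, e1, e2; reflexivity|].
      apply gen_mul; auto.
    - intros x a [e1 w3]; split; [|apply gen_inv; auto].
      rewrite hom_inv, e1 by auto; symmetry; apply hom_inv, sub_incl_hom.
    - intros a [e1 _]; apply hker; rewrite e1; reflexivity.
    - intros x a []; auto.
    - intros [b j] hl; pose proof (proj1 hl) as hb; unfold inner in hb; simpl in hb; subst b.
      assert (hf : W P (p (f (false, j)))).
      { replace (f (false, j)) with (zpow t j ** g ** inv (zpow t j)).
        - rewrite !hp, hom_inv, hom_zpow by auto.
          apply gen_mul; [apply gen_mul|apply gen_inv]; auto; apply sub_zpow; auto;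
            apply W_sub.
        - change (cj (zpow t j) g = f (false, j)); unfold g; rewrite conj_tf; auto. }
      destruct (sub_lift (subgroup_preimage B A q _ hq (W_sub P)) _ hf) as [b hb].
      exists b; split; [symmetry; exact hb|apply W_f; auto]. }
  specialize (section_bound n _ hn 0 _ hs); lia.
Qed.

(** * The EA-class of the group and of its covers *)

Lemma cover_has_section (B : group) (q : B -> A) m : is_hom B A q ->
  (forall w, W inner w -> exists b, q b = w) -> has_section B 0 m.
Proof.
  intros hq hsur; exists (fun b a => q b = a /\ W (rng 0 m) a); split.
  - split; [apply hom_one; auto|apply gen_one].
  - intros x y a b [<- ?] [<- ?]; split; [apply hq|apply gen_mul; auto].
  - intros x a [<- ?]; split; [apply hom_inv; auto|apply gen_inv; auto].
  - intros a [<- _]; apply hom_one; auto.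
  - intros x a []; auto.
  - intros l hl; destruct (hsur (f l)) as [b hb]; [apply W_f, hl|].
    exists b; split; [auto|apply W_f; auto].
Qed.

Lemma A_class : finitely_generated A -> EA_class_is A (OmegaPlus 2).
Proof.
  assert (hid : is_hom A A (fun a => a)) by (intros a b; auto).
  intros hfg; split.
  - apply (cover_EG (fun a => a) hid (fun _ => True)); eauto.
    + intros k l; auto.
    + intros x y -> ->; auto.
    + apply all_nf.
  - apply fg_not_EG; auto; intros m; apply (cover_has_section A (fun a => a)); eauto.
Qed.

Lemma cover_class (B : group) (q : B -> A) : finitely_generated B -> is_hom B A q ->
  (forall b, nf inner (q b)) -> (forall w, W inner w -> exists b, q b = w) ->
  (exists b, q b = t) -> (forall x y, q (x ** y) = q (y ** x) -> x ** y = y ** x) ->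
  EA_class_is B (OmegaPlus 2).
Proof.
  intros hfg hq hnf hsur ht hcomm; split.
  - apply (cover_EG q hq inner); auto; [apply inner_stable|].
    intros x y hx hy; apply hcomm; rewrite !hq, hx, hy; auto.
  - apply fg_not_EG; auto; intros m; apply (cover_has_section B q); auto.
Qed.

End Tri.

(** * Coordinates on the orbit of the common centre *)

Definition idx_dec (a b : idx) : {a = b} + {a <> b} := excluded_middle_informative (a = b).

Definition upd (x : idx -> Z) (l : idx) (k : Z) : idx -> Z :=
  fun m => if idx_dec m l then k else x m.

Lemma upd_eq x l k : upd x l k l = k.
Proof. unfold upd; destruct idx_dec; congruence. Qed.

Lemma upd_neq x l k m : m <> l -> upd x l k m = x m.
Proof. unfold upd; destruct idx_dec; congruence. Qed.

Lemma upd_upd x l j k : upd (upd x l j) l k = upd x l k.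
Proof. extensionality m; unfold upd; destruct idx_dec; auto. Qed.

Lemma upd_same x l k : x l = k -> upd x l k = x.
Proof. intros e; extensionality m; unfold upd; destruct idx_dec; congruence. Qed.

Section Geometry.
Context {A : group} {Y : Type} (ev : A -> Y -> Y) (c : Y) (f : idx -> A) (t : A)
  (I : idx -> Y -> Prop).

(** The support one step earlier in the same copy of the integers; in the model below this is the
    preimage of [I l] under [t]. *)
Definition core (l : idx) : Y -> Prop := I (shift (-1) l).

Record nested_bumps : Prop := {
  ev_one : forall y, ev gone y = y;
  ev_mul : forall a b y, ev (a ** b) y = ev a (ev b y);
  ev_inj : forall a, (forall y, ev a y = y) -> a = gone;
  nb_tc : ev t c = c;
  nb_tf : forall l, t ** f l = f (shift 1 l) ** t;
  nb_gen : forall a, gen (fun s => s = f (false, 0) \/ s = f (true, 0) \/ s = t) a;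
  nb_c : forall l, I l c;
  nb_lt : forall m l y, ilt m l -> I m y -> core l y;
  nb_core : forall l y, core l y -> I l y;
  nb_off : forall l y, ~ I l y -> ev (f l) y = y;
  nb_on : forall l y, I l (ev (f l) y) <-> I l y;
  nb_disj : forall l k y, k <> 0 -> core l y -> ~ core l (ev (zpow (f l) k) y)
}.

Context (N : nested_bumps).

Lemma ev_Vl a y : ev (inv a) (ev a y) = y.
Proof. rewrite <- (ev_mul N), inv_mul; apply N. Qed.

Lemma ev_Vr a y : ev a (ev (inv a) y) = y.
Proof. rewrite <- (ev_mul N), mul_inv; apply N. Qed.

Lemma fpow_on l k y : I l (ev (zpow (f l) k) y) <-> I l y.
Proof.
  revert k; refine (Z_ind_iff _ _ _).
  - simpl; rewrite (ev_one N); tauto.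
  - intros k; rewrite zpow_succ_l, (ev_mul N), (nb_on N); tauto.
Qed.

Lemma fpow_off l k y : ~ I l y -> ev (zpow (f l) k) y = y.
Proof.
  intros h; revert k; refine (Z_ind_iff _ _ _).
  - apply N.
  - intros k; rewrite zpow_succ_l, (ev_mul N), (nb_off N); [tauto|].
    rewrite fpow_on; auto.
Qed.

Lemma core_c l : core l c.
Proof. apply N. Qed.

(** The point [f_l1^k1 (f_l2^k2 (... c))], with [l1 > l2 > ...], has coordinate [ki] at [li] and [0]
    at every other index. *)
Inductive coord : Y -> (idx -> Z) -> Prop :=
| coord_zero : coord c (fun _ => 0)
| coord_step y x l k : coord y x -> (forall m, ~ ilt m l -> x m = 0) -> k <> 0 ->
    coord (ev (zpow (f l) k) y) (upd x l k).

(** The last bump applied has some index [n] below [l] and keeps the point inside [I n], which lies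
    in the core of [l]. *)
Lemma coord_core y x l : coord y x -> (forall m, ~ ilt m l -> x m = 0) -> core l y.
Proof.
  intros h; revert l; induction h as [|y x n k h IH hx hk]; intros l hl.
  - apply core_c.
  - assert (hn : ilt n l).
    { apply NNPP; intros hn; apply hk; rewrite <- (hl n hn); symmetry; apply upd_eq. }
    apply (nb_lt N n); auto; apply fpow_on, N, IH; auto.
Qed.

(** A nonzero power of [f l] pushes the point out of the core of [l], and that core contains the
    cores of lower index. *)
Lemma coord_step_not_core y x l k m : coord y x -> (forall m, ~ ilt m l -> x m = 0) ->
  k <> 0 -> ~ ilt l m -> ~ core m (ev (zpow (f l) k) y).
Proof.
  intros h hx hk hm hc; apply (nb_disj N l k y hk).
  - apply (coord_core _ x); auto.
  - destruct (ilt_total l m) as [?|[<-|hlt]]; [tauto|auto|].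
    apply (nb_lt N m); auto; apply N; auto.
Qed.

(** Of two different outermost indices, the larger would put the point outside a core in which the
    smaller keeps it; so the outermost index is determined. Displacement of the core then determines
    the exponent. *)
Lemma coord_fun y x x' : coord y x -> coord y x' -> x = x'.
Proof.
  intros h; revert x'; induction h as [|y x l k h IH hx hk]; intros x' h'.
  - inversion h' as [e1 e2|y' x1 l k h1 hx1 hk1 e1 e2]; auto.
    destruct (coord_step_not_core y' x1 l k l h1 hx1 hk1 (ilt_irrefl l)).
    rewrite e1; apply core_c.
  - inversion h' as [e1 e2|y' x1 l' k' h1 hx1 hk1 e1 e2].
    + destruct (coord_step_not_core y x l k l h hx hk (ilt_irrefl l)).
      rewrite <- e1; apply core_c.
    + assert (el : l = l').
      { destruct (ilt_total l l') as [hlt|[->|hlt]]; auto; exfalso.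
        - apply (coord_step_not_core y' x1 l' k' l' h1 hx1 hk1 (ilt_irrefl l')).
          rewrite e1; apply (nb_lt N l); auto; apply fpow_on, N, (coord_core y x); auto.
        - apply (coord_step_not_core y x l k l h hx hk (ilt_irrefl l)).
          rewrite <- e1; apply (nb_lt N l'); auto.
          apply fpow_on, N, (coord_core y' x1); auto. }
      subst l'.
      assert (e3 : ev (zpow (f l) (k - k')) y = y').
      { rewrite <- (ev_Vl (zpow (f l) k') y'), e1, <- (ev_mul N), <- zpow_opp, <- zpow_add.
        do 2 f_equal; lia. }
      destruct (Z.eq_dec k k') as [<-|ne].
      * replace (k - k) with 0 in e3 by lia; simpl in e3; rewrite (ev_one N) in e3.
        subst y'; rewrite (IH x1); auto.
      * destruct (nb_disj N l (k - k') y); [lia|apply (coord_core y x); auto|].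
        rewrite e3; apply (coord_core y' x1); auto.
Qed.

Lemma coord_inj y y' x : coord y x -> coord y' x -> y = y'.
Proof.
  intros h; revert y'; induction h as [|y x l k h IH hx hk]; intros y' h'.
  - inversion h' as [e1 e2|y1 x1 l k h1 hx1 hk1 e1 e2]; auto.
    destruct hk1; rewrite <- (upd_eq x1 l k), e2; reflexivity.
  - inversion h' as [e1 e2|y1 x1 l' k' h1 hx1 hk1 e1 e2].
    + destruct hk; rewrite <- (upd_eq x l k), <- e2; reflexivity.
    + assert (el : l = l').
      { destruct (ilt_total l l') as [hlt|[->|hlt]]; auto; exfalso;
          pose proof (ilt_neq _ _ hlt) as ne.
        - apply hk1; rewrite <- (upd_eq x1 l' k'), e2, upd_neq by auto.
          apply hx; intros h2; exact (ilt_irrefl _ (ilt_trans _ _ _ hlt h2)).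
        - apply hk; rewrite <- (upd_eq x l k), <- e2, upd_neq by auto.
          apply hx1; intros h2; exact (ilt_irrefl _ (ilt_trans _ _ _ hlt h2)). }
      subst l'.
      assert (ek : k' = k) by (rewrite <- (upd_eq x1 l k'), e2; apply upd_eq); subst k'.
      f_equal; apply IH; replace x with x1; auto.
      extensionality m; destruct (classic (m = l)) as [->|ne].
      * rewrite hx, hx1; auto using ilt_irrefl.
      * rewrite <- (upd_neq x1 l k), e2, upd_neq by auto; reflexivity.
Qed.

(** A nonzero coordinate at [m] above [l] puts the point outside the core of [m], which contains the
    support [I l]. *)
Lemma coord_f_off y x l m e : coord y x -> ilt l m -> x m <> 0 -> ev (zpow (f l) e) y = y.
Proof.
  intros h hlm hm; apply fpow_off; intros hI.
  destruct h as [|y x n k h hx hk]; [congruence|].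
  assert (hnm : ~ ilt n m).
  { intros hlt; apply hm; rewrite upd_neq by (intros ->; exact (ilt_irrefl _ hlt)).
    apply hx; intros h2; exact (ilt_irrefl _ (ilt_trans _ _ _ hlt h2)). }
  apply (coord_step_not_core y x n k m h hx hk hnm).
  apply (nb_lt N l); auto.
Qed.

Lemma coord_f_on y x l e : coord y x -> (forall m, ilt l m -> x m = 0) ->
  coord (ev (zpow (f l) e) y) (upd x l (x l + e)).
Proof.
  intros h hl; destruct (Z.eq_dec e 0) as [->|he].
  - simpl; rewrite (ev_one N), upd_same; auto; lia.
  - assert (hstep : x l = 0 -> coord (ev (zpow (f l) e) y) (upd x l (x l + e))).
    { intros e0; rewrite e0; apply coord_step; auto.
      intros m hm; destruct (ilt_total l m) as [?|[<-|?]]; auto; tauto. }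
    destruct h as [|y x n k h hx hk]; [apply hstep; auto|].
    destruct (classic (l = n)) as [->|ne].
    + rewrite upd_eq, upd_upd, <- (ev_mul N), <- zpow_add.
      (* When the exponents cancel, the outermost factor disappears and the coordinate is 0
         again. *)
      destruct (Z.eq_dec (k + e) 0) as [e0|ne].
      * rewrite e0; replace (e + k) with 0 by lia.
        simpl; rewrite (ev_one N), upd_same; auto; apply hx, ilt_irrefl.
      * rewrite (Z.add_comm e); apply coord_step; auto.
    + apply hstep; rewrite upd_neq by auto.
      apply hx; intros hlt; apply hk; rewrite <- (hl n hlt); symmetry; apply upd_eq.
Qed.

Lemma tpow_c k : ev (zpow t k) c = c.
Proof.
  revert k; refine (Z_ind_iff _ _ _).
  - apply N.
  - intros k; rewrite zpow_succ_l, (ev_mul N); split; intros e; [rewrite e; apply N|].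
    rewrite <- (ev_Vl t (ev (zpow t k) c)), e.
    pose proof (ev_Vl t c) as h; rewrite (nb_tc N) in h; exact h.
Qed.

Lemma coord_t y x e : coord y x ->
  coord (ev (zpow t e) y) (fun m => x (shift (- e) m)).
Proof.
  induction 1 as [|y x l k h IH hx hk].
  - rewrite tpow_c; apply coord_zero.
  - assert (e1 : zpow t e ** zpow (f l) k = zpow (f (shift e l)) k ** zpow t e)
      by (apply zpow_intertwine, shift_pow, N).
    rewrite <- (ev_mul N), e1, (ev_mul N).
    replace (fun m => upd x l k (shift (- e) m))
      with (upd (fun m => x (shift (- e) m)) (shift e l) k).
    + apply coord_step; auto; intros m hm; apply hx; intros h2; apply hm.
      revert h2; destruct l as [[] ?], m as [[] ?]; unfold ilt, shift; simpl; auto; lia.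
    + extensionality m; destruct (classic (m = shift e l)) as [->|ne].
      * rewrite shift_shift; replace (e + - e) with 0 by lia.
        rewrite shift_zero, !upd_eq; auto.
      * rewrite !upd_neq; auto; intros h2; apply ne; rewrite <- h2, shift_shift.
        replace (- e + e) with 0 by lia; symmetry; apply shift_zero.
Qed.

(** * The action on the points with coordinates *)

Definition orbit : Type := {y : Y | exists x, coord y x}.

Lemma orbit_closed a y : (exists x, coord y x) -> exists x, coord (ev a y) x.
Proof.
  revert y; apply (gen_ind_monoid A (fun s => s = f (false, 0) \/ s = f (true, 0) \/ s = t)
    (fun a => forall y, (exists x, coord y x) -> exists x, coord (ev a y) x)).
  - intros; rewrite (ev_one N); auto.
  - assert (hf : forall l e y, (exists x, coord y x) ->
      exists x, coord (ev (zpow (f l) e) y) x).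
    { intros l e y [x hx]; destruct (classic (forall m, ilt l m -> x m = 0)) as [h|h].
      - eexists; apply coord_f_on; eauto.
      - apply not_all_ex_not in h as [m h]; apply imply_to_and in h as [h1 h2].
        exists x; rewrite (coord_f_off y x l m); auto. }
    assert (ht : forall e y, (exists x, coord y x) -> exists x, coord (ev (zpow t e) y) x)
      by (intros e y [x hx]; eexists; apply coord_t; eauto).
    intros s hs; split; intros y hy.
    + rewrite <- (zpow_one A s); destruct hs as [->|[->| ->]]; auto.
    + rewrite <- (zpow_opp_one A s); destruct hs as [->|[->| ->]]; auto.
  - intros; rewrite (ev_mul N); auto.
  - apply N.
Qed.

Definition orbit_act (a : A) (y : orbit) : orbit :=
  exist _ (ev a (proj1_sig y)) (orbit_closed a _ (proj2_sig y)).

Definition orbit_co (y : orbit) : idx -> Z :=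
  proj1_sig (constructive_indefinite_description _ (proj2_sig y)).

Definition centre : orbit := exist _ c (ex_intro _ _ coord_zero).

Lemma orbit_coord (y : orbit) : coord (proj1_sig y) (orbit_co y).
Proof. exact (proj2_sig (constructive_indefinite_description _ (proj2_sig y))). Qed.

Lemma orbit_co_eq (y : orbit) x : coord (proj1_sig y) x -> orbit_co y = x.
Proof. apply coord_fun, orbit_coord. Qed.

(** ** Faithfulness on the orbit *)

Lemma W_core P l a y : (forall m, P m -> ilt m l) -> W f P a -> core l (ev a y) <-> core l y.
Proof.
  intros hP ha; revert a ha y.
  apply (W_ind f P (fun a => forall y, core l (ev a y) <-> core l y)).
  - intros y; rewrite (ev_one N); tauto.
  - intros m hm.
    assert (h : forall y, core l (ev (f m) y) <-> core l y).
    { intros y; destruct (classic (I m y)) as [hy|hy]; [|rewrite (nb_off N); tauto].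
      pose proof (proj2 (nb_on N m y) hy) as hy'.
      apply (nb_lt N m l _ (hP m hm)) in hy, hy'; tauto. }
    split; auto; intros y; rewrite <- h, ev_Vr; tauto.
  - intros a b _ _ h1 h2 y; rewrite (ev_mul N), h1; auto.
Qed.

(** An element of [W f P] acts on the translates of [core l] by a wreath recursion whose entries
    are words in the lower generators. *)
Lemma W_decompose P P' l : (forall m, P m -> P' m \/ m = l) -> (forall m, P' m -> ilt m l) ->
  forall w, W f P w -> exists k (b : Z -> A), (forall j, W f P' (b j))
  /\ (forall j y, core l y ->
       ev w (ev (zpow (f l) j) y) = ev (zpow (f l) (j + k)) (ev (b j) y))
  /\ (forall y, (forall j y', core l y' -> y <> ev (zpow (f l) j) y') ->
       ev w y = ev (zpow (f l) k) y).
Proof.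
  intros hP hlt; refine (W_ind f P _ _ _ _).
  - exists 0, (fun _ => gone); split; [intros; apply gen_one|].
    split; intros; rewrite ?Z.add_0_r, ?(ev_one N); auto.
  - intros m hm; destruct (hP m hm) as [hm'| ->].
    + assert (h : forall g, (g = f m \/ g = inv (f m)) ->
        exists k (b : Z -> A), (forall j, W f P' (b j))
        /\ (forall j y, core l y ->
             ev g (ev (zpow (f l) j) y) = ev (zpow (f l) (j + k)) (ev (b j) y))
        /\ (forall y, (forall j y', core l y' -> y <> ev (zpow (f l) j) y') ->
             ev g y = ev (zpow (f l) k) y)).
      { intros g hg.
        assert (hgW : W f P' g)
          by (destruct hg as [->| ->]; [apply W_f|apply gen_inv, W_f]; auto).
        assert (hoff : forall y, ~ core l y -> ev g y = y).
        { intros y hy; assert (hI : ~ I m y) by (intros hI; apply hy, (nb_lt N m); auto).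
          destruct hg as [->| ->]; [apply N; auto|].
          rewrite <- (nb_off N m y hI) at 1; apply ev_Vl. }
        (* A lower generator is supported in the core of [l]: it is its own entry at 0, and all
           other entries are trivial. *)
        exists 0, (fun j => if Z.eq_dec j 0 then g else gone); split; [|split].
        - intros j; destruct Z.eq_dec; [auto|apply gen_one].
        - intros j y hy; destruct Z.eq_dec as [->|ne].
          + simpl; rewrite !(ev_one N); auto.
          + rewrite Z.add_0_r, (ev_one N); apply hoff, N; auto.
        - intros y hy; simpl; rewrite (ev_one N); apply hoff; intros hc.
          apply (hy 0 y hc); symmetry; apply N. }
      split; apply h; auto.
    + split; [exists 1|exists (-1)]; exists (fun _ => gone); (split; [intros; apply gen_one|]);
        split; intros.
      * rewrite (ev_one N), zpow_succ_l, (ev_mul N); auto.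
      * rewrite zpow_one; auto.
      * rewrite (ev_one N); change (j + -1) with (j - 1); rewrite zpow_pred_l, (ev_mul N); auto.
      * change (zpow (f l) (-1)) with (zpow (f l) (- (1))); rewrite zpow_opp, zpow_one; auto.
  - intros u v _ _ (k & b & hb & h1 & h2) (k' & b' & hb' & h1' & h2').
    (* The right factor carries translate [j] to translate [j + k'], which selects the entry of the
       left factor. *)
    exists (k' + k), (fun j => b (j + k') ** b' j); split; [intros; apply gen_mul; [apply hb|apply hb']|].
    split.
    + intros j y hy; rewrite !(ev_mul N), (h1' j y hy), h1.
      * do 2 f_equal; lia.
      * apply (W_core P'); auto.
    + intros y hy; rewrite (ev_mul N), (h2' y hy), h2.
      * rewrite <- (ev_mul N), <- zpow_add; do 2 f_equal; lia.
      * intros j y' hy' e; apply (hy (j - k') y' hy').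
        rewrite <- (ev_Vl (zpow (f l) k') y), e, <- zpow_opp, <- (ev_mul N), <- zpow_add.
        do 2 f_equal; lia.
Qed.

(** Induction on the index set, splitting off the largest index [l]: fixing [c] kills the exponent
    of [f l], and fixing the translates of points of its core kills the entries. Test points have
    coordinates supported on [P], so that the hypothesis passes to the entries. *)
Lemma W_faithful n : forall P ls, (length ls <= n)%nat -> (forall l, P l -> In l ls) ->
  forall w, W f P w ->
  (forall y x, coord y x -> (forall l, x l <> 0 -> P l) -> ev w y = y) -> w = gone.
Proof.
  induction n as [|n IH]; intros P ls hlen hls w hw hfix.
  - destruct ls; [|simpl in hlen; lia].
    revert hw; apply gen_empty; intros y (l & hl & _); exact (hls l hl).
  - destruct (classic (exists l, P l)) as [hex|hno].
    2: { revert hw; apply gen_empty; intros y (l & hl & _); eauto. }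
    destruct (max_exists P) as [l [hl hmax]]; [exists ls; auto|auto|].
    set (P' := fun m => P m /\ ilt m l).
    assert (hP' : forall m, P m -> P' m \/ m = l).
    { intros m hm; destruct (ilt_total m l) as [?|[?|h]]; auto; [left; split; auto|].
      destruct (hmax m hm h). }
    destruct (W_decompose P P' l hP' (fun m h => proj2 h) w hw) as (k & b & hb & h1 & h2).
    assert (hk : k = 0).
    { apply NNPP; intros hk.
      specialize (h1 0 c (core_c l)); simpl in h1; rewrite (ev_one N) in h1.
      rewrite (hfix c (fun _ => 0) coord_zero) in h1 by (intros; lia).
      apply (nb_disj N l k (ev (b 0) c) hk).
      - apply (W_core P'); auto; [intros m []; auto|apply core_c].
      - rewrite <- h1; apply core_c. }
    subst k.
    assert (hb1 : forall j, b j = gone).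
    { intros j; apply (IH P' (remove idx_dec l ls)); auto.
      - pose proof (remove_length_lt idx_dec ls l (hls l hl)); lia.
      - intros m [hm hlt]; apply in_in_remove; auto using ilt_neq.
      - intros y x hx hsup.
        assert (hz : forall m, ~ ilt m l -> x m = 0)
          by (intros m hm; apply NNPP; intros h; destruct (hsup m h); auto).
        assert (hc : core l y) by (apply (coord_core y x); auto).
        specialize (h1 j y hc); rewrite Z.add_0_r in h1.
        rewrite (hfix _ (upd x l (x l + j))) in h1.
        + rewrite <- (ev_Vl (zpow (f l) j) (ev (b j) y)), <- h1, ev_Vl; auto.
        + apply coord_f_on; auto; intros m hm; apply hz; intros hn.
          exact (ilt_irrefl _ (ilt_trans _ _ _ hm hn)).
        + intros m; destruct (classic (m = l)) as [->|ne]; auto.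
          rewrite upd_neq by auto; intros h; apply (hsup m h). }
    apply N; intros y.
    destruct (classic (exists j y', core l y' /\ y = ev (zpow (f l) j) y'))
      as [(j & y' & hy & ->)|hn].
    + rewrite h1, hb1, (ev_one N), Z.add_0_r; auto.
    + rewrite h2; [apply N|]; intros j y' hy' e; apply hn; eauto.
Qed.

Lemma orbit_chain : chain_action orbit_act orbit_co centre f t.
Proof.
  assert (hco : forall a (y : orbit) x, coord (ev a (proj1_sig y)) x ->
    orbit_co (orbit_act a y) = x) by (intros a y x h; apply orbit_co_eq, h).
  split.
  - intros y; apply sig_ext, N.
  - intros a b y; apply sig_ext; apply (ev_mul N).
  - intros x y h; apply sig_ext, (coord_inj _ _ (orbit_co x)); [apply orbit_coord|].
    replace (orbit_co x) with (orbit_co y) by (extensionality l; auto); apply orbit_coord.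
  - intros l; rewrite (orbit_co_eq centre (fun _ => 0)); auto; apply coord_zero.
  - intros l x hx.
    pose proof (coord_f_on _ _ l 1 (orbit_coord x) hx) as h; rewrite zpow_one in h.
    rewrite (hco _ _ _ h); apply upd_eq.
  - intros l m x hm; destruct (classic (up0 orbit_co l x)) as [hx|hx].
    + pose proof (coord_f_on _ _ l 1 (orbit_coord x) hx) as h; rewrite zpow_one in h.
      rewrite (hco _ _ _ h); apply upd_neq; auto.
    + apply not_all_ex_not in hx as [n hx]; apply imply_to_and in hx as [h1 h2].
      pose proof (coord_f_off _ _ l n 1 (orbit_coord x) h1 h2) as h; rewrite zpow_one in h.
      rewrite (hco _ _ (orbit_co x)); auto; rewrite h; apply orbit_coord.
  - intros l x hx.
    apply not_all_ex_not in hx as [n hx]; apply imply_to_and in hx as [h1 h2].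
    pose proof (coord_f_off _ _ l n 1 (orbit_coord x) h1 h2) as h; rewrite zpow_one in h.
    apply sig_ext; exact h.
  - intros x l; pose proof (coord_t _ _ 1 (orbit_coord x)) as h; rewrite zpow_one in h.
    rewrite (hco _ _ _ h), shift_shift; simpl Z.add; rewrite shift_zero; auto.
  - apply N.
  - apply N.
  - intros w hw h.
    destruct (W_fin f (fun _ => True) w hw) as (Q & [ls hls] & _ & hQ).
    apply (W_faithful (length ls) Q ls (Nat.le_refl _) hls w hQ).
    intros y x hx _; exact (f_equal (@proj1_sig _ _) (h (exist _ y (ex_intro _ x hx)))).
Qed.

End Geometry.

Open Scope R_scope.

(** * Piecewise linear homeomorphisms *)

Lemma dyadic_IZR a : dyadic (IZR a).
Proof. exists a, O; simpl; field. Qed.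

Lemma dyadic_add x y : dyadic x -> dyadic y -> dyadic (x + y).
Proof.
  intros (a & m & ->) (b & n & ->).
  exists (a * 2 ^ Z.of_nat n + b * 2 ^ Z.of_nat m)%Z, (m + n)%nat.
  rewrite plus_IZR, !mult_IZR, <- !pow_IZR, pow_add.
  field; split; apply pow_nonzero; lra.
Qed.

Lemma dyadic_mul x y : dyadic x -> dyadic y -> dyadic (x * y).
Proof.
  intros (a & m & ->) (b & n & ->); exists (a * b)%Z, (m + n)%nat.
  rewrite mult_IZR, pow_add; field; split; apply pow_nonzero; lra.
Qed.

Lemma dyadic_sub x y : dyadic x -> dyadic y -> dyadic (x - y).
Proof.
  intros hx hy; replace (x - y) with (x + IZR (-1) * y) by lra.
  apply dyadic_add; auto; apply dyadic_mul; auto; apply dyadic_IZR.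
Qed.

Lemma dyadic_half x : dyadic x -> dyadic (x / 2).
Proof.
  intros (a & n & ->); exists a, (S n); simpl; field; apply pow_nonzero; lra.
Qed.

Lemma dyadic_powerRZ k : dyadic (powerRZ 2 k).
Proof.
  destruct k as [|p|p]; simpl.
  - apply (dyadic_IZR 1).
  - exists (2 ^ Z.pos p)%Z, O.
    replace (Z.pos p) with (Z.of_nat (Pos.to_nat p)) by lia.
    rewrite <- pow_IZR; simpl; field.
  - exists 1%Z, (Pos.to_nat p); unfold Rdiv; lra.
Qed.

Ltac dyadic_tac :=
  repeat first [assumption | apply dyadic_IZR | apply dyadic_powerRZ | apply dyadic_half
               | apply dyadic_sub | apply dyadic_add | apply dyadic_mul].

(** Concatenation replaces explicit partitions. Offsets are dyadic so that dyadic points have dyadic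
    images, as composition requires. *)
Inductive pwl (F : R -> R) : R -> R -> Prop :=
| pwl_aff a b k d : a < b -> dyadic a -> dyadic b -> dyadic d ->
    (forall x, a <= x <= b -> F x = powerRZ 2 k * x + d) -> pwl F a b
| pwl_cat a b c : pwl F a b -> pwl F b c -> pwl F a c.

(** Quantifying over all dyadic intervals lets the outer function of a composition be used on
    whatever interval the inner one produces. *)
Definition locally_pwl (F : R -> R) : Prop :=
  forall a b, a < b -> dyadic a -> dyadic b -> pwl F a b.

Lemma pwl_lt F a b : pwl F a b -> a < b.
Proof. induction 1; lra. Qed.

Lemma pwl_dyadic F a b : pwl F a b -> dyadic b.
Proof. induction 1; auto. Qed.

Lemma pwl_comp_affine h u v : pwl h u v -> forall F a b k d, dyadic a -> dyadic b -> dyadic d ->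
  (forall x, a <= x <= b -> F x = powerRZ 2 k * x + d) -> a < b ->
  u = powerRZ 2 k * a + d -> v = powerRZ 2 k * b + d -> pwl (fun x => h (F x)) a b.
Proof.
  induction 1 as [u v j e huv hu hv he hj|u m v h1 IH1 h2 IH2];
    intros F a b k d ha hb hd hF hab eu ev;
    assert (hk : 0 < powerRZ 2 k) by (apply powerRZ_lt; lra).
  - apply (pwl_aff _ a b (j + k) (powerRZ 2 j * d + e)); auto; [dyadic_tac|].
    intros x hx; rewrite (hF x hx), hj, powerRZ_add; [ring|lra|].
    subst u v; split; apply Rplus_le_compat_r, Rmult_le_compat_l; lra.
  - pose proof (pwl_lt _ _ _ h1) as l1; pose proof (pwl_lt _ _ _ h2) as l2.
    (* The preimage of the breakpoint [m] under the affine map; it is dyadic because the slope is a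
       power of 2. *)
    set (w := powerRZ 2 (- k) * (m - d)).
    assert (hw : powerRZ 2 k * w + d = m).
    { unfold w; rewrite <- Rmult_assoc, <- powerRZ_add by lra.
      rewrite Z.add_opp_diag_r; simpl; lra. }
    pose proof (pwl_dyadic _ _ _ h1) as hm.
    assert (ha' : a < w) by (apply (Rmult_lt_reg_l (powerRZ 2 k)); lra).
    assert (hb' : w < b) by (apply (Rmult_lt_reg_l (powerRZ 2 k)); lra).
    assert (dw : dyadic w) by (unfold w; dyadic_tac).
    apply (pwl_cat _ a w b).
    + apply (IH1 F a w k d); auto; intros x hx; apply hF; lra.
    + apply (IH2 F w b k d); auto; intros x hx; apply hF; lra.
Qed.

Lemma pwl_comp h F a b : locally_pwl h -> pwl F a b -> pwl (fun x => h (F x)) a b.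
Proof.
  intros hh; induction 1 as [a b k d hab ha hb hd hF|a b c _ IH1 _ IH2].
  - assert (hk : 0 < powerRZ 2 k) by (apply powerRZ_lt; lra).
    apply (pwl_comp_affine h (powerRZ 2 k * a + d) (powerRZ 2 k * b + d)) with (k := k) (d := d);
      auto.
    apply hh; [|dyadic_tac|dyadic_tac].
    apply Rplus_lt_compat_r, Rmult_lt_compat_l; auto.
  - apply (pwl_cat _ a b c); auto.
Qed.

(** Accumulates affine pieces from left to right, so that a function is checked one formula at a
    time. *)
Definition pwl_below (F : R -> R) (p : R) : Prop :=
  forall a b, a < b -> b <= p -> dyadic a -> dyadic b -> pwl F a b.

Lemma pwl_below_extend F p q k d : dyadic p -> dyadic d ->
  (forall x, p <= x <= q -> F x = powerRZ 2 k * x + d) -> pwl_below F p -> pwl_below F q.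
Proof.
  intros hp hd hF hb a b hab hbq ha hb'.
  destruct (Rle_dec b p) as [h|h]; [apply hb; auto|].
  destruct (Rle_dec p a) as [h'|h'].
  - apply (pwl_aff _ a b k d); auto; intros x hx; apply hF; lra.
  - apply (pwl_cat _ a p b); [apply hb; auto; lra|].
    apply (pwl_aff _ p b k d); auto; [lra|]; intros x hx; apply hF; lra.
Qed.

Lemma pwl_below_start F p : (forall x, x <= p -> F x = x) -> pwl_below F p.
Proof.
  intros hF a b hab hbp ha hb; apply (pwl_aff _ a b 0 (IZR 0)); auto; [apply dyadic_IZR|].
  intros x hx; rewrite hF by lra; simpl; lra.
Qed.

Lemma pwl_below_all F q : dyadic q -> (forall x, q <= x -> F x = x) -> pwl_below F q ->
  locally_pwl F.
Proof.
  intros hq hF hb a b hab ha hb'.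
  apply (pwl_below_extend F q (Rmax b q) 0 (IZR 0)); auto; [apply dyadic_IZR| |apply Rmax_l].
  intros x hx; rewrite hF by lra; simpl; lra.
Qed.

Lemma pwl_partition F a b : pwl F a b -> exists (n : nat) (p : nat -> R),
  p O = a /\ p n = b /\ (forall i, (i < n)%nat -> p i < p (S i)) /\
  (forall i, (i <= n)%nat -> dyadic (p i)) /\
  (forall i, (i < n)%nat -> exists (k : Z) (d : R),
     forall x, p i <= x <= p (S i) -> F x = powerRZ 2 k * x + d).
Proof.
  induction 1 as [a b k d hab ha hb hd hF
    |a b c _ (n & p & p0 & pn & h1 & h2 & h3) _ (m & r & r0 & rm & h4 & h5 & h6)].
  - exists 1%nat, (fun i => match i with O => a | _ => b end).
    repeat split; auto.
    + intros [|i] hi; [auto|lia].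
    + intros [|i] hi; auto.
    + intros [|i] hi; [|lia]; exists k, d; auto.
  - set (s := fun i => if le_dec i n then p i else r (i - n)%nat).
    assert (s1 : forall i, (i <= n)%nat -> s i = p i)
      by (intros i hi; unfold s; destruct le_dec; [auto|lia]).
    assert (s2 : forall i, s (n + i)%nat = r i).
    { intros i; unfold s; destruct le_dec as [h|h].
      - replace i with O by lia; rewrite Nat.add_0_r; congruence.
      - f_equal; lia. }
    assert (hi : forall i, (i < n)%nat \/ exists j, i = (n + j)%nat).
    { intros i; destruct (Nat.lt_ge_cases i n); [left; auto|right; exists (i - n)%nat; lia]. }
    exists (n + m)%nat, s; split; [rewrite s1; auto; lia|]; split; [rewrite s2; auto|].
    split; [|split]; intros i hlt; destruct (hi i) as [h|[j ->]].
    + rewrite !s1 by lia; auto.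
    + rewrite plus_n_Sm, !s2; apply h4; lia.
    + rewrite s1 by lia; apply h2; lia.
    + rewrite s2; apply h5; lia.
    + rewrite !s1 by lia; auto.
    + rewrite plus_n_Sm, !s2; apply h6; lia.
Qed.

(** Surjectivity is obtained from an inverse of the same kind, carried along in [inverse_pair]. *)
Record pl (F : R -> R) : Prop := {
  pl_pwl : locally_pwl F;
  pl_incr : forall x y, x < y -> F x < F y;
  pl_id : forall x, x <= 0 \/ 1 <= x -> F x = x
}.

Lemma pl_one : pl (fun x => x).
Proof.
  split; auto; apply (pwl_below_all _ 0); auto; [apply (dyadic_IZR 0)|].
  apply pwl_below_start; auto.
Qed.

Lemma pl_comp F G : pl F -> pl G -> pl (fun x => F (G x)).
Proof.
  intros hF hG; split.
  - intros a b hab ha hb; apply pwl_comp; [|apply hG]; auto; apply hF.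
  - intros; apply hF, hG; auto.
  - intros x hx; rewrite (pl_id G hG), (pl_id F hF); auto.
Qed.

Lemma incr_le F x y : (forall x y, x < y -> F x < F y) -> x <= y -> F x <= F y.
Proof. intros h [hlt| ->]; [left; auto|right; auto]. Qed.

Lemma incr_lt_inv F x y : (forall x y, x < y -> F x < F y) -> F x < F y -> x < y.
Proof.
  intros h hlt; apply Rnot_le_lt; intros hle; apply (incr_le F) in hle; auto; lra.
Qed.

Lemma pl_inF F G : pl F -> pl G -> (forall x, F (G x) = x) -> inF F.
Proof.
  intros hF hG e; pose proof (pl_incr F hF) as iF; pose proof (pl_incr G hG) as iG.
  assert (f0 : F 0 = 0) by (apply hF; lra).
  assert (f1 : F 1 = 1) by (apply hF; lra).
  assert (g0 : G 0 = 0) by (apply hG; lra).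
  assert (g1 : G 1 = 1) by (apply hG; lra).
  split; [|split; [|split; [|split]]].
  - intros x hx; apply hF; lra.
  - intros x hx; rewrite <- f0, <- f1; split; apply incr_le; auto; lra.
  - intros y hy; exists (G y); split; auto.
    rewrite <- g0, <- g1; split; apply incr_le; auto; lra.
  - intros x y _ h _; auto.
  - apply pwl_partition, (pl_pwl F hF); [lra|apply (dyadic_IZR 0)|apply (dyadic_IZR 1)].
Qed.

(** * Dyadic bumps with slopes 2, 1 and 1/2 *)

Definition bump (p q x : R) : R :=
  if Rle_dec x p then x else
  if Rle_dec x (p + (q - p) / 4) then p + 2 * (x - p) else
  if Rle_dec x (p + (q - p) / 2) then x + (q - p) / 4 else
  if Rle_dec x q then q - (q - x) / 2 else x.

Definition unbump (p q x : R) : R :=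
  if Rle_dec x p then x else
  if Rle_dec x (p + (q - p) / 2) then p + (x - p) / 2 else
  if Rle_dec x (p + 3 * ((q - p) / 4)) then x - (q - p) / 4 else
  if Rle_dec x q then q - 2 * (q - x) else x.

Ltac bump_tac := unfold bump, unbump; repeat destruct Rle_dec; try lra.

Lemma bump_unbump p q x : p < q -> bump p q (unbump p q x) = x.
Proof. intros h; bump_tac. Qed.

Lemma unbump_bump p q x : p < q -> unbump p q (bump p q x) = x.
Proof. intros h; bump_tac. Qed.

Lemma bump_incr p q x y : p < q -> x < y -> bump p q x < bump p q y.
Proof. intros h hx; bump_tac. Qed.

Lemma unbump_incr p q x y : p < q -> x < y -> unbump p q x < unbump p q y.
Proof. intros h hx; bump_tac. Qed.

Lemma bump_out p q x : p < q -> x <= p \/ q <= x -> bump p q x = x.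
Proof. intros h hx; bump_tac. Qed.

Lemma unbump_out p q x : p < q -> x <= p \/ q <= x -> unbump p q x = x.
Proof. intros h hx; bump_tac. Qed.

Lemma bump_ge p q x : p < q -> x <= bump p q x.
Proof. intros h; bump_tac. Qed.

Lemma dyadic_quarter x : dyadic x -> dyadic (x / 4).
Proof. intros h; replace (x / 4) with (x / 2 / 2) by lra; dyadic_tac. Qed.

Lemma pl_bump p q : 0 <= p -> p < q -> q <= 1 -> dyadic p -> dyadic q -> pl (bump p q).
Proof.
  intros h0 h h1 hp hq.
  assert (h4 : dyadic ((q - p) / 4)) by (apply dyadic_quarter; dyadic_tac).
  split; [|intros; apply bump_incr; auto|intros; apply bump_out; auto; lra].
  apply (pwl_below_all _ q); auto; [intros; apply bump_out; auto|].
  (* The pieces are peeled off from right to left, with slope exponents -1, 0 and 1. Offsets take a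
     shape that [dyadic_tac] recognises: [p - IZR 2 * p] stands for [- p]. *)
  apply (pwl_below_extend _ (p + (q - p) / 2) _ (-1) (q / 2)); [dyadic_tac|dyadic_tac| |].
  { intros x hx; simpl powerRZ; bump_tac. }
  apply (pwl_below_extend _ (p + (q - p) / 4) _ 0 ((q - p) / 4)); [dyadic_tac|dyadic_tac| |].
  { intros x hx; simpl powerRZ; bump_tac. }
  apply (pwl_below_extend _ p _ 1 (p - IZR 2 * p)); [dyadic_tac|dyadic_tac| |].
  { intros x hx; simpl powerRZ; bump_tac. }
  apply pwl_below_start; intros; apply bump_out; auto.
Qed.

Lemma pl_unbump p q : 0 <= p -> p < q -> q <= 1 -> dyadic p -> dyadic q -> pl (unbump p q).
Proof.
  intros h0 h h1 hp hq.
  assert (h4 : dyadic ((q - p) / 4)) by (apply dyadic_quarter; dyadic_tac).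
  split; [|intros; apply unbump_incr; auto|intros; apply unbump_out; auto; lra].
  apply (pwl_below_all _ q); auto; [intros; apply unbump_out; auto|].
  apply (pwl_below_extend _ (p + 3 * ((q - p) / 4)) _ 1 (q - IZR 2 * q));
    [dyadic_tac|dyadic_tac| |].
  { intros x hx; simpl powerRZ; bump_tac. }
  apply (pwl_below_extend _ (p + (q - p) / 2) _ 0 (p - p - (q - p) / 4));
    [dyadic_tac|dyadic_tac| |].
  { intros x hx; simpl powerRZ; bump_tac. }
  apply (pwl_below_extend _ p _ (-1) (p / 2)); [dyadic_tac|dyadic_tac| |].
  { intros x hx; simpl powerRZ; bump_tac. }
  apply pwl_below_start; intros; apply unbump_out; auto.
Qed.

(** * Subgroups generated by finitely many homeomorphisms *)

Record inverse_pair (h h' : R -> R) : Prop := {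
  ip_l : pl h;
  ip_r : pl h';
  ip_lr : forall x, h (h' x) = x;
  ip_rl : forall x, h' (h x) = x
}.

Lemma inverse_pair_sym h h' : inverse_pair h h' -> inverse_pair h' h.
Proof. intros []; split; auto. Qed.

Lemma inverse_pair_comp h h' k k' : inverse_pair h h' -> inverse_pair k k' ->
  inverse_pair (fun x => h (k x)) (fun x => k' (h' x)).
Proof.
  intros H1 H2; split; try (apply pl_comp; [apply H1 || apply H2|apply H1 || apply H2]).
  - intros x; rewrite (ip_lr _ _ H2); apply H1.
  - intros x; rewrite (ip_rl _ _ H1); apply H2.
Qed.

Lemma inverse_pair_bump p q : 0 <= p -> p < q -> q <= 1 -> dyadic p -> dyadic q ->
  inverse_pair (bump p q) (unbump p q).
Proof.
  intros; split; intros.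
  - apply pl_bump; auto.
  - apply pl_unbump; auto.
  - apply bump_unbump; auto.
  - apply unbump_bump; auto.
Qed.

Section Generated.
Context (ps : list ((R -> R) * (R -> R))).

Definition letter (h : R -> R) : Prop :=
  exists pr, In pr ps /\ (h = fst pr \/ h = snd pr).

Inductive word : (R -> R) -> Prop :=
| word_nil : word (fun x => x)
| word_cons h F : letter h -> word F -> word (fun x => h (F x)).

Lemma word_letter h : letter h -> word h.
Proof. intros hh; exact (word_cons h _ hh word_nil). Qed.

Lemma word_app F G : word F -> word G -> word (fun x => F (G x)).
Proof.
  intros hF hG; induction hF as [|h F hh _ IH]; [exact hG|].
  exact (word_cons h _ hh IH).
Qed.

Context (hps : forall pr, In pr ps -> inverse_pair (fst pr) (snd pr)).

Lemma letter_inv h : letter h -> exists h', letter h' /\ inverse_pair h h'.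
Proof.
  intros (pr & hin & [->| ->]); [exists (snd pr)|exists (fst pr)]; split; try (exists pr; auto).
  - auto.
  - apply inverse_pair_sym; auto.
Qed.

Lemma word_inv F : word F -> exists G, word G /\ inverse_pair F G.
Proof.
  induction 1 as [|h F hh _ (G & hG & iG)].
  - exists (fun x => x); repeat split; auto using word_nil; apply pl_one.
  - destruct (letter_inv h hh) as (h' & hh' & ih).
    exists (fun x => G (h' x)); split; [apply word_app; auto using word_letter|].
    apply inverse_pair_comp; auto.
Qed.

Lemma word_subgroup : subgroupF word.
Proof.
  split.
  - intros F hF; destruct (word_inv F hF) as (G & _ & iG).
    apply (pl_inF F G); apply iG.
  - apply word_nil.
  - intros; apply word_app; auto.
  - intros F hF; destruct (word_inv F hF) as (G & hG & iG); exists G; split; auto.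
    split; extensionality x; apply iG.
Qed.

Definition word_group : group := subgroup_group word word_subgroup.

Definition ev (a : word_group) : R -> R := proj1_sig a.

Lemma ev_ext (a b : word_group) : (forall x, ev a x = ev b x) -> a = b.
Proof. intros h; apply sgF_eq; extensionality x; apply h. Qed.

Lemma word_group_fg (L : list word_group) :
  (forall pr, In pr ps -> exists a, In a L /\ ev a = fst pr) -> forall a, in_gen word_group L a.
Proof.
  intros hL [F hF].
  enough (h : exists a : word_group, in_gen word_group L a /\ ev a = F).
  { destruct h as (a & ha & e); replace (exist _ F hF : word_group) with a; auto.
    apply ev_ext; rewrite e; auto. }
  induction hF as [|h F (pr & hin & hh) hF (a & ha & e)].
  - exists gone; split; [apply in_gen_one|reflexivity].
  - destruct (hL pr hin) as (b & hb & eb).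
    destruct hh as [->| ->].
    + exists (b ** a); split; [apply in_gen_mul; auto; apply in_gen_gen; auto|].
      rewrite <- eb, <- e; reflexivity.
    + exists (inv b ** a); split.
      * apply in_gen_mul; auto; apply (in_gen_inv _ _ b); [apply in_gen_gen; auto|apply mul_inv].
      * extensionality x; rewrite <- e.
        change (ev (inv b) (ev a x) = snd pr (ev a x)).
        rewrite <- (ip_rl _ _ (hps pr hin) (ev (inv b) (ev a x))), <- eb; f_equal.
        change (ev (b ** inv b) (ev a x) = ev a x); rewrite mul_inv; reflexivity.
Qed.

End Generated.

(** * The two groups *)

(** [tF] fixes [1/8], [1/4], [3/8] and [1/2]; it pushes points of [(1/8, 3/8)] away from [1/4] and the
    other points of [(0, 1/2)] away from [[1/8, 3/8]]. The powers of the bumps [gF] and [fF] are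
    large enough to displace the preimages of their supports under [tF]. *)
Definition tF (x : R) : R :=
  unbump 0 (1/8) (unbump (1/8) (1/4) (bump (1/4) (3/8) (bump (3/8) (1/2) x))).
Definition tV (x : R) : R :=
  unbump (3/8) (1/2) (unbump (1/4) (3/8) (bump (1/8) (1/4) (bump 0 (1/8) x))).

Definition gB : R -> R := bump (3/16) (5/16).
Definition gF (x : R) : R := gB (gB x).
Definition gV (x : R) : R := unbump (3/16) (5/16) (unbump (3/16) (5/16) x).

Definition fB : R -> R := bump (1/16) (7/16).
Definition fU : R -> R := unbump (1/16) (7/16).
Definition fF (x : R) : R := fB (fB (fB (fB (fB (fB x))))).
Definition fV (x : R) : R := fU (fU (fU (fU (fU (fU x))))).

Definition zF : R -> R := bump (1/2) 1.
Definition zV : R -> R := unbump (1/2) 1.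

Lemma dyadic_16 a : dyadic (IZR a / 16).
Proof. exists a, 4%nat; simpl; field. Qed.

Lemma inverse_pair_bump16 a b : (0 <= a)%Z -> (a < b)%Z -> (b <= 16)%Z ->
  forall p q, p = IZR a / 16 -> q = IZR b / 16 -> inverse_pair (bump p q) (unbump p q).
Proof.
  intros h1 h2 h3 p q -> ->; apply IZR_le in h1, h3; apply IZR_lt in h2.
  apply inverse_pair_bump; try lra; apply dyadic_16.
Qed.

Lemma tF_pair : inverse_pair tF tV.
Proof.
  assert (i1 : inverse_pair (unbump 0 (1/8)) (bump 0 (1/8)))
    by (apply inverse_pair_sym, (inverse_pair_bump16 0 2); lia || lra).
  assert (i2 : inverse_pair (unbump (1/8) (1/4)) (bump (1/8) (1/4)))
    by (apply inverse_pair_sym, (inverse_pair_bump16 2 4); lia || lra).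
  assert (i3 : inverse_pair (bump (1/4) (3/8)) (unbump (1/4) (3/8)))
    by (apply (inverse_pair_bump16 4 6); lia || lra).
  assert (i4 : inverse_pair (bump (3/8) (1/2)) (unbump (3/8) (1/2)))
    by (apply (inverse_pair_bump16 6 8); lia || lra).
  exact (inverse_pair_comp _ _ _ _ i1
    (inverse_pair_comp _ _ _ _ i2 (inverse_pair_comp _ _ _ _ i3 i4))).
Qed.

Lemma gF_pair : inverse_pair gF gV.
Proof.
  assert (i : inverse_pair gB (unbump (3/16) (5/16)))
    by (apply (inverse_pair_bump16 3 5); lia || lra).
  exact (inverse_pair_comp _ _ _ _ i i).
Qed.

Lemma fF_pair : inverse_pair fF fV.
Proof.
  assert (i : inverse_pair fB fU) by (apply (inverse_pair_bump16 1 7); lia || lra).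
  exact (inverse_pair_comp _ _ _ _ i (inverse_pair_comp _ _ _ _ i (inverse_pair_comp _ _ _ _ i
    (inverse_pair_comp _ _ _ _ i (inverse_pair_comp _ _ _ _ i i))))).
Qed.

Lemma zF_pair : inverse_pair zF zV.
Proof. apply (inverse_pair_bump16 8 16); lia || lra. Qed.

Definition ps1 : list ((R -> R) * (R -> R)) := ((gF, gV) :: (fF, fV) :: (tF, tV) :: nil)%list.
Definition ps0 : list ((R -> R) * (R -> R)) := ((gF, gV) :: (tF, tV) :: (zF, zV) :: nil)%list.

Lemma ps1_pairs pr : In pr ps1 -> inverse_pair (fst pr) (snd pr).
Proof.
  intros [<-|[<-|[<-|[]]]]; [apply gF_pair|apply fF_pair|apply tF_pair].
Qed.

Lemma ps0_pairs pr : In pr ps0 -> inverse_pair (fst pr) (snd pr).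
Proof.
  intros [<-|[<-|[<-|[]]]]; [apply gF_pair|apply tF_pair|apply zF_pair].
Qed.

Definition G1 : group := word_group ps1 ps1_pairs.
Definition G0 : group := word_group ps0 ps0_pairs.
Definition ev1 : G1 -> R -> R := ev ps1 ps1_pairs.
Definition ev0 : G0 -> R -> R := ev ps0 ps0_pairs.

Lemma letter_in ps h h' : In (h, h') ps -> letter ps h.
Proof. intros hin; exists (h, h'); auto. Qed.

Definition g1 : G1 := exist _ gF (word_letter _ _ (letter_in ps1 gF gV (or_introl eq_refl))).
Definition f1 : G1 :=
  exist _ fF (word_letter _ _ (letter_in ps1 fF fV (or_intror (or_introl eq_refl)))).
Definition t1 : G1 :=
  exist _ tF (word_letter _ _ (letter_in ps1 tF tV (or_intror (or_intror (or_introl eq_refl))))).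
Definition g0 : G0 := exist _ gF (word_letter _ _ (letter_in ps0 gF gV (or_introl eq_refl))).
Definition t0 : G0 :=
  exist _ tF (word_letter _ _ (letter_in ps0 tF tV (or_intror (or_introl eq_refl)))).
Definition z0 : G0 :=
  exist _ zF (word_letter _ _ (letter_in ps0 zF zV (or_intror (or_intror (or_introl eq_refl))))).

Lemma G1_gen a : in_gen G1 (g1 :: f1 :: t1 :: nil) a.
Proof.
  apply word_group_fg; intros pr [<-|[<-|[<-|[]]]];
    [exists g1|exists f1|exists t1]; simpl; auto.
Qed.

Lemma G0_gen a : in_gen G0 (g0 :: t0 :: z0 :: nil) a.
Proof.
  apply word_group_fg; intros pr [<-|[<-|[<-|[]]]];
    [exists g0|exists t0|exists z0]; simpl; auto.
Qed.

(** ** Supports and displacement of the generators *)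

Definition lo (b : bool) : R := if b then 1/16 else 3/16.
Definition hi (b : bool) : R := if b then 7/16 else 5/16.
(** [lo'] and [hi'] bound the preimage under [tF] of the interval from [lo] to [hi]. *)
Definition lo' (b : bool) : R := if b then 3/32 else 7/32.
Definition hi' (b : bool) : R := if b then 13/32 else 9/32.
Definition Ib (b : bool) (y : R) : Prop := lo b < y < hi b.

Lemma tF_incr x y : x < y -> tF x < tF y.
Proof. apply (pl_incr _ (ip_l _ _ tF_pair)). Qed.

Lemma tF_lo' b : tF (lo' b) = lo b.
Proof.
  unfold tF, lo', lo; destruct b.
  - rewrite (bump_out (3/8)), (bump_out (1/4)), (unbump_out (1/8)) by lra; bump_tac.
  - rewrite (bump_out (3/8)), (bump_out (1/4)) by lra.
    assert (e : unbump (1/8) (1/4) (7/32) = 3/16) by bump_tac.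
    rewrite e; apply unbump_out; lra.
Qed.

Lemma tF_hi' b : tF (hi' b) = hi b.
Proof.
  unfold tF, hi', hi; destruct b.
  - assert (e : bump (3/8) (1/2) (13/32) = 7/16) by bump_tac.
    rewrite e, (bump_out (1/4)), (unbump_out (1/8)), (unbump_out 0) by lra; lra.
  - rewrite (bump_out (3/8)) by lra.
    assert (e : bump (1/4) (3/8) (9/32) = 5/16) by bump_tac.
    rewrite e, (unbump_out (1/8)), (unbump_out 0) by lra; lra.
Qed.

Lemma tF_fix x : x = 1/8 \/ x = 1/4 \/ x = 3/8 \/ 1/2 <= x -> tF x = x.
Proof.
  intros h; unfold tF; rewrite (bump_out (3/8)), (bump_out (1/4)), (unbump_out (1/8)) by lra.
  apply unbump_out; lra.
Qed.

Lemma incr_pair_iff F l h y : (forall x y, x < y -> F x < F y) ->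
  l < y < h <-> F l < F y < F h.
Proof.
  intros i; split; intros [h1 h2]; split; auto; apply (incr_lt_inv F); auto.
Qed.

Lemma Ib_tF b u : Ib b (tF u) <-> lo' b < u < hi' b.
Proof.
  unfold Ib; rewrite <- (tF_lo' b), <- (tF_hi' b).
  symmetry; apply incr_pair_iff, tF_incr.
Qed.

Definition base (b : bool) : G1 := if b then f1 else g1.

Lemma base_incr b x y : x < y -> ev1 (base b) x < ev1 (base b) y.
Proof.
  destruct b; [apply (pl_incr _ (ip_l _ _ fF_pair))|apply (pl_incr _ (ip_l _ _ gF_pair))].
Qed.

Lemma base_ge b x : x <= ev1 (base b) x.
Proof.
  assert (hf : forall x, x <= fB x) by (intros; apply bump_ge; lra).
  assert (hg : forall x, x <= gB x) by (intros; apply bump_ge; lra).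
  destruct b; [change (x <= fF x); unfold fF|change (x <= gF x); unfold gF].
  - do 5 (eapply Rle_trans; [|apply hf]); apply hf.
  - eapply Rle_trans; [apply hg|]; apply hg.
Qed.

Lemma base_off b y : ~ Ib b y -> ev1 (base b) y = y.
Proof.
  intros h.
  destruct b; [change (fF y = y)|change (gF y = y)]; unfold Ib in h; simpl in h.
  - assert (e : fB y = y) by (apply bump_out; lra); unfold fF; rewrite !e; auto.
  - assert (e : gB y = y) by (apply bump_out; lra); unfold gF; rewrite !e; auto.
Qed.

Lemma base_on b y : Ib b (ev1 (base b) y) <-> Ib b y.
Proof.
  unfold Ib.
  rewrite <- (base_off b (lo b)) at 1 by (unfold Ib; lra).
  rewrite <- (base_off b (hi b)) at 1 by (unfold Ib; lra).
  symmetry; apply incr_pair_iff, base_incr.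
Qed.

(** For [fF], five steps of [fB] from 3/32 reach only 51/128, short of 13/32, and the sixth passes
    it; for [gF], two steps of [gB] land exactly on 9/32. *)
Lemma base_jump b : hi' b <= ev1 (base b) (lo' b).
Proof.
  destruct b; unfold hi', lo'.
  - change (13/32 <= fF (3/32)); unfold fF.
    assert (e1 : fB (3/32) = 4/32) by (unfold fB; bump_tac).
    assert (e2 : fB (4/32) = 6/32) by (unfold fB; bump_tac).
    assert (e3 : fB (6/32) = 9/32) by (unfold fB; bump_tac).
    assert (e4 : fB (9/32) = 23/64) by (unfold fB; bump_tac).
    assert (e5 : fB (23/64) = 51/128) by (unfold fB; bump_tac).
    assert (e6 : fB (51/128) = 107/256) by (unfold fB; bump_tac).
    rewrite e1, e2, e3, e4, e5, e6; lra.
  - change (9/32 <= gF (7/32)); unfold gF.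
    assert (e1 : gB (7/32) = 8/32) by (unfold gB; bump_tac).
    assert (e2 : gB (8/32) = 9/32) by (unfold gB; bump_tac).
    rewrite e1, e2; lra.
Qed.

Lemma base_npow_ge b n x : x <= ev1 (npow (base b) n) x.
Proof.
  induction n as [|n IH]; [right; reflexivity|].
  change (x <= ev1 (base b) (ev1 (npow (base b) n) x)).
  eapply Rle_trans; [exact IH|apply base_ge].
Qed.

Lemma base_npow_jump b n x : lo' b < x -> hi' b <= ev1 (npow (base b) (S n)) x.
Proof.
  intros hx; change (hi' b <= ev1 (base b) (ev1 (npow (base b) n) x)).
  eapply Rle_trans; [apply base_jump|left; apply base_incr].
  eapply Rlt_le_trans; [exact hx|apply base_npow_ge].
Qed.

Lemma ev1_cancel a y : ev1 a (ev1 (inv a) y) = y.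
Proof. change (ev1 (a ** inv a) y = y); rewrite mul_inv; reflexivity. Qed.

Lemma ev1_cancel' a y : ev1 (inv a) (ev1 a y) = y.
Proof. change (ev1 (inv a ** a) y = y); rewrite inv_mul; reflexivity. Qed.

(** A positive power carries the interval past its right end; for a negative power the point and its
    image exchange roles. *)
Lemma base_zpow_disj b k x : k <> 0%Z -> lo' b < x < hi' b ->
  ~ (lo' b < ev1 (zpow (base b) k) x < hi' b).
Proof.
  intros hk [h1 h2] [h3 h4].
  destruct (Z_lt_le_dec k 0) as [h|h].
  - set (v := ev1 (zpow (base b) k) x) in *.
    assert (e : x = ev1 (npow (base b) (S (Z.to_nat (- k - 1)))) v).
    { rewrite <- zpow_of_nat.
      replace (Z.of_nat (S (Z.to_nat (- k - 1)))) with (- k)%Z by lia.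
      rewrite zpow_opp; unfold v; rewrite ev1_cancel'; auto. }
    pose proof (base_npow_jump b (Z.to_nat (- k - 1)) v h3); lra.
  - replace k with (Z.of_nat (S (Z.to_nat (k - 1)))) in h4 by lia.
    rewrite zpow_of_nat in h4.
    pose proof (base_npow_jump b (Z.to_nat (k - 1)) x h1); lra.
Qed.

(** ** The nested bumps *)

Definition tp (k : Z) : G1 := zpow t1 k.

Definition fl (l : idx) : G1 := tp (snd l) ** base (fst l) ** inv (tp (snd l)).

Definition Il (l : idx) (y : R) : Prop := Ib (fst l) (ev1 (inv (tp (snd l))) y).

Lemma core_iff l y : core Il l y <-> Ib (fst l) (tF (ev1 (inv (tp (snd l))) y)).
Proof.
  unfold core, Il, shift; simpl.
  replace (inv (tp (snd l + -1))) with (t1 ** inv (tp (snd l))); [reflexivity|].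
  unfold tp; rewrite <- !zpow_opp, <- zpow_succ_l; f_equal; lia.
Qed.

Lemma core_range l y : core Il l y <->
  lo' (fst l) < ev1 (inv (tp (snd l))) y < hi' (fst l).
Proof. rewrite core_iff; apply Ib_tF. Qed.

Lemma core_Il l y : core Il l y -> Il l y.
Proof.
  rewrite core_range; unfold Il, Ib; destruct (fst l); simpl; lra.
Qed.

Lemma Il_mono b i y n : Il (b, i) y -> Il (b, (i + Z.of_nat n)%Z) y.
Proof.
  intros h; induction n as [|n IH]; [rewrite Z.add_0_r; auto|].
  apply core_Il; unfold core, shift; simpl.
  replace (i + Z.pos (Pos.of_succ_nat n) + -1)%Z with (i + Z.of_nat n)%Z by lia; auto.
Qed.

(** This interval separates the two chains: it contains every inner support and lies in every outer
    core. *)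
Lemma middle_invariant k y : 1/8 < ev1 (tp k) y < 3/8 <-> 1/8 < y < 3/8.
Proof.
  revert k; refine (Z_ind_iff _ _ _).
  - tauto.
  - intros k; unfold tp; rewrite zpow_succ_l.
    change (ev1 (t1 ** zpow t1 k) y) with (tF (ev1 (zpow t1 k) y)).
    enough (e : forall x, 1/8 < tF x < 3/8 <-> 1/8 < x < 3/8) by (rewrite e; tauto).
    intros x; rewrite <- (tF_fix (1/8)) at 1 by auto.
    rewrite <- (tF_fix (3/8)) at 1 by auto.
    symmetry; apply incr_pair_iff, tF_incr.
Qed.

Lemma fl_ev l y : ev1 (fl l) y =
  ev1 (tp (snd l)) (ev1 (base (fst l)) (ev1 (inv (tp (snd l))) y)).
Proof. reflexivity. Qed.

Lemma fl_zero b : fl (b, 0%Z) = base b.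
Proof.
  change (gone ** base b ** inv (@gone G1) = base b).
  rewrite inv_one, gone_r, gone_l; reflexivity.
Qed.

Lemma G1_bumps : nested_bumps ev1 (1/4) fl t1 Il.
Proof.
  assert (tc : forall k, ev1 (tp k) (1/4) = 1/4).
  { refine (Z_ind_iff _ _ _); [reflexivity|intros k].
    unfold tp; rewrite zpow_succ_l.
    change (ev1 (t1 ** zpow t1 k) (1/4)) with (tF (ev1 (zpow t1 k) (1/4))).
    assert (e : tF (1/4) = 1/4) by (apply tF_fix; auto).
    split; intros h; [rewrite h; auto|].
    rewrite <- (ip_rl _ _ tF_pair (ev1 (zpow t1 k) (1/4))), h, <- e at 1.
    apply tF_pair. }
  split.
  - reflexivity.
  - reflexivity.
  - intros a h; apply ev_ext; auto.
  - apply tF_fix; auto.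
  - intros [b i].
    change (t1 ** (tp i ** base b ** inv (tp i)) = tp (i + 1) ** base b ** inv (tp (i + 1)) ** t1).
    replace (tp (i + 1)) with (t1 ** tp i) by (symmetry; apply zpow_succ_l).
    rewrite inv_prod, !gassoc, mul_inv_assoc; reflexivity.
  - intros a; generalize (gen_of_in_gen _ _ _ (G1_gen a)); apply gen_mono.
    intros y hy; apply gen_base; rewrite !fl_zero; simpl in hy.
    destruct hy as [<-|[<-|[<-|[]]]]; auto.
  - intros l; unfold Il, tp; rewrite <- zpow_opp.
    change (Ib (fst l) (ev1 (tp (- snd l)) (1/4))); rewrite tc.
    unfold Ib; destruct (fst l); simpl; lra.
  - intros [b i] [b' j] y hlt hI.
    destruct b, b'; unfold ilt in hlt; simpl in hlt; try tauto.
    + apply (Il_mono true i y (Z.to_nat (j - 1 - i))) in hI.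
      replace (i + Z.of_nat (Z.to_nat (j - 1 - i)))%Z with (j + -1)%Z in hI by lia; exact hI.
    + apply core_range; simpl.
      assert (hy : 1/8 < y < 3/8).
      { apply (middle_invariant (- i)); unfold tp; rewrite zpow_opp.
        revert hI; unfold Il, Ib, tp; simpl; lra. }
      apply (middle_invariant (- j)) in hy; unfold tp in *; rewrite zpow_opp in hy; lra.
    + apply (Il_mono false i y (Z.to_nat (j - 1 - i))) in hI.
      replace (i + Z.of_nat (Z.to_nat (j - 1 - i)))%Z with (j + -1)%Z in hI by lia; exact hI.
  - apply core_Il.
  - intros l y h; rewrite fl_ev, base_off, ev1_cancel; auto.
  - intros l y; unfold Il; rewrite fl_ev, ev1_cancel'; apply base_on.
  - intros l k y hk hc; rewrite core_range in hc |- *.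
    (* Conjugation by a power of [t1] reduces displacement by [fl l] to displacement by [base]. *)
    assert (e : ev1 (inv (tp (snd l))) (ev1 (zpow (fl l) k) y)
      = ev1 (zpow (base (fst l)) k) (ev1 (inv (tp (snd l))) y)).
    { assert (h : inv (tp (snd l)) ** zpow (fl l) k
        = zpow (base (fst l)) k ** inv (tp (snd l))).
      { apply zpow_intertwine; unfold fl; rewrite !gassoc, inv_mul, gone_l; reflexivity. }
      exact (f_equal (fun a => ev1 a y) h). }
    rewrite e; apply base_zpow_disj; auto.
Qed.

Lemma G1_chain : exists (X : Type) (act : G1 -> X -> X) co o, chain_action act co o fl t1.
Proof. eexists _, _, _, _; exact (orbit_chain ev1 (1/4) fl t1 Il G1_bumps). Qed.

(** ** Restriction to the left half *)

(** Words over [ps0] preserve both sides of 1/2, so replacing the right part by the identity is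
    multiplicative on them. *)
Definition trunc (F : R -> R) (y : R) : R := if Rle_dec y (1/2) then F y else y.

Lemma letter0_cases h : letter ps0 h ->
  (letter ps1 h /\ forall y, 1/2 <= y -> h y = y) \/
  ((h = zF \/ h = zV) /\ forall y, y <= 1/2 -> h y = y).
Proof.
  assert (fixV : forall h h' y, inverse_pair h h' -> h y = y -> h' y = y)
    by (intros k k' y i e; rewrite <- e at 1; apply i).
  assert (hg : forall y, 1/2 <= y -> gF y = y)
    by (intros y hy; apply (base_off false); unfold Ib; simpl; lra).
  assert (ht : forall y, 1/2 <= y -> tF y = y) by (intros; apply tF_fix; auto).
  assert (hz : forall y, y <= 1/2 -> zF y = y) by (intros; apply bump_out; lra).
  intros (pr & [<-|[<-|[<-|[]]]] & [->| ->]); simpl fst; simpl snd.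
  - left; split; auto; exists (gF, gV); simpl; auto.
  - left; split; [exists (gF, gV); simpl; auto|].
    intros y hy; apply (fixV _ _ _ gF_pair); auto.
  - left; split; auto; exists (tF, tV); simpl; auto.
  - left; split; [exists (tF, tV); simpl; auto|].
    intros y hy; apply (fixV _ _ _ tF_pair); auto.
  - right; auto.
  - right; split; auto; intros y hy; apply (fixV _ _ _ zF_pair); auto.
Qed.

Lemma letter0_half h y : letter ps0 h -> h y <= 1/2 <-> y <= 1/2.
Proof.
  intros hl; destruct (letter_inv ps0 ps0_pairs h hl) as (h' & _ & i).
  assert (e : h (1/2) = 1/2)
    by (destruct (letter0_cases h hl) as [[_ e]|[_ e]]; apply e; lra).
  rewrite <- e at 1; split; intros hy.
  - apply Rnot_lt_le; intros hlt; apply (pl_incr _ (ip_l _ _ i)) in hlt; lra.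
  - apply incr_le; auto; apply i.
Qed.

Lemma word0_half F y : word ps0 F -> F y <= 1/2 <-> y <= 1/2.
Proof.
  induction 1 as [|h F hh _ IH]; [tauto|]; rewrite letter0_half; auto.
Qed.

Lemma trunc_comp F G : word ps0 G ->
  trunc (fun x => F (G x)) = (fun x => trunc F (trunc G x)).
Proof.
  intros hG; extensionality y; unfold trunc; destruct (Rle_dec y (1/2)) as [h|h].
  - apply (word0_half G y hG) in h; destruct Rle_dec; tauto.
  - destruct Rle_dec; tauto.
Qed.

Lemma trunc_id F : (forall y, y <= 1/2 -> F y = y) -> trunc F = (fun x => x).
Proof. intros h; extensionality y; unfold trunc; destruct Rle_dec; auto. Qed.

Lemma trunc_left F : (forall y, 1/2 <= y -> F y = y) -> trunc F = F.
Proof.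
  intros h; extensionality y; unfold trunc; destruct Rle_dec; auto; rewrite h; lra.
Qed.

Lemma trunc_word F : word ps0 F -> word ps1 (trunc F).
Proof.
  induction 1 as [|h F hh hF IH].
  - rewrite trunc_id; auto; apply word_nil.
  - rewrite trunc_comp by auto; apply word_app; auto.
    destruct (letter0_cases h hh) as [[hl e]|[_ e]].
    + rewrite trunc_left; auto; apply word_letter; auto.
    + rewrite trunc_id; auto; apply word_nil.
Qed.

(** On the right half only [zF] and its inverse act, and these commute. *)
Lemma word0_comm_right F G y : word ps0 F -> word ps0 G -> 1/2 < y -> F (G y) = G (F y).
Proof.
  assert (hright : forall F y, word ps0 F -> 1/2 < y -> 1/2 < F y)
    by (intros K x hK hx; apply Rnot_le_lt; rewrite word0_half by auto; lra).
  assert (hll : forall h k y, letter ps0 h -> letter ps0 k -> 1/2 < y -> h (k y) = k (h y)).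
  { intros h k x hh hk hx.
    assert (hhx : 1/2 < h x) by (apply hright; auto; apply word_letter; auto).
    assert (hkx : 1/2 < k x) by (apply hright; auto; apply word_letter; auto).
    destruct (letter0_cases h hh) as [[_ e]|[eh _]].
    - rewrite !e by lra; auto.
    - destruct (letter0_cases k hk) as [[_ e]|[ek _]]; [rewrite !e by lra; auto|].
      destruct eh as [->| ->], ek as [->| ->]; auto;
        rewrite (ip_lr _ _ zF_pair), (ip_rl _ _ zF_pair); auto. }
  assert (hlw : forall h F y, letter ps0 h -> word ps0 F -> 1/2 < y -> h (F y) = F (h y)).
  { intros h K x hh hK; revert x; induction hK as [|k K hk hK IH]; intros x hx; auto.
    rewrite hll, IH; auto. }
  intros hF; revert y; induction hF as [|h F hh hF IH]; intros y hG hy; auto.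
  rewrite IH by auto; apply hlw; auto.
Qed.

(** Projection along the central factor generated by [z0], onto the subgroup of [G1] generated by
    [g1] and [t1]. *)
Definition q (a : G0) : G1 := exist _ (trunc (proj1_sig a)) (trunc_word _ (proj2_sig a)).

Lemma q_hom : is_hom G0 G1 q.
Proof.
  intros a b; apply ev_ext; intros y.
  change (trunc (fun x => ev0 a (ev0 b x)) y = trunc (ev0 a) (trunc (ev0 b) y)).
  rewrite trunc_comp; auto; exact (proj2_sig b).
Qed.

Lemma q_g : q g0 = g1.
Proof.
  apply ev_ext; intros y; change (trunc gF y = gF y); rewrite trunc_left; auto.
  intros x hx; apply (base_off false); unfold Ib; simpl; lra.
Qed.

Lemma q_t : q t0 = t1.
Proof.
  apply ev_ext; intros y; change (trunc tF y = tF y); rewrite trunc_left; auto.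
  intros x hx; apply tF_fix; auto.
Qed.

Lemma q_z : q z0 = gone.
Proof.
  apply ev_ext; intros y; change (trunc zF y = y); rewrite trunc_id; auto.
  intros x hx; apply bump_out; lra.
Qed.

Lemma q_reflects_comm (x y : G0) : q (x ** y) = q (y ** x) -> x ** y = y ** x.
Proof.
  intros e; apply ev_ext; intros s.
  destruct (Rle_dec s (1/2)) as [h|h].
  - apply (f_equal (fun a => ev1 a s)) in e.
    change (trunc (ev0 (x ** y)) s = trunc (ev0 (y ** x)) s) in e.
    unfold trunc in e; destruct (Rle_dec s (1/2)); [exact e|tauto].
  - apply (word0_comm_right (ev0 x) (ev0 y)); [exact (proj2_sig x)|exact (proj2_sig y)|lra].
Qed.

Lemma q_onto w : W fl inner w -> exists b, q b = w.
Proof.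
  induction 1 as [|a ([b i] & hl & ->)|a _ [x <-]|a b _ [x <-] _ [y <-]].
  - exists gone; apply hom_one, q_hom.
  - unfold inner in hl; simpl in hl; subst b.
    exists (zpow t0 i ** g0 ** inv (zpow t0 i)).
    rewrite !q_hom, hom_inv, hom_zpow, q_g, q_t by apply q_hom; reflexivity.
  - exists (inv x); apply hom_inv, q_hom.
  - exists (x ** y); apply q_hom.
Qed.

Theorem theorem1p8 :
  exists (S0 S1 : (R -> R) -> Prop) (h0 : subgroupF S0) (h1 : subgroupF S1),
    finitely_generated (subgroup_group S0 h0) /\
    finitely_generated (subgroup_group S1 h1) /\
    EA_class_is (subgroup_group S0 h0) (OmegaPlus 2) /\
    EA_class_is (subgroup_group S1 h1) (OmegaPlus 2) /\
    ~ embeds (subgroup_group S0 h0) (subgroup_group S1 h1) /\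
    ~ embeds (subgroup_group S1 h1) (subgroup_group S0 h0).
Proof.
  exists (word ps0), (word ps1), (word_subgroup ps0 ps0_pairs), (word_subgroup ps1 ps1_pairs).
  change (subgroup_group (word ps0) (word_subgroup ps0 ps0_pairs)) with G0.
  change (subgroup_group (word ps1) (word_subgroup ps1 ps1_pairs)) with G1.
  assert (fg0 : finitely_generated G0) by (eexists; apply G0_gen).
  assert (fg1 : finitely_generated G1) by (eexists; apply G1_gen).
  destruct G1_chain as (X & act & co & o & H).
  (* The generators of [G0] are sent to [g1], [t1] and the identity, so the outer chain does not
     occur in the image. *)
  assert (hnf : forall b, nf fl t1 inner (q b)).
  { pose proof (nf_subgroup act co o fl t1 H inner inner_stable) as hs.
    intros b; generalize (gen_of_in_gen _ _ _ (G0_gen b)).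
    induction 1 as [|b hb|b _ IH|b b' _ IH _ IH'].
    - rewrite (hom_one _ _ _ q_hom); apply hs.
    - destruct hb as [<-|[<-|[<-|[]]]].
      + rewrite q_g, <- (fl_zero false : _ = g1); apply nf_W, W_f; reflexivity.
      + rewrite q_t; apply nf_t.
      + rewrite q_z; apply hs.
    - rewrite (hom_inv _ _ _ _ q_hom); apply hs; auto.
    - rewrite q_hom; apply hs; auto. }
  split; [exact fg0|]; split; [exact fg1|]; split; [|split; [|split]].
  - apply (cover_class act co o fl t1 H G0 q); auto using q_hom, q_onto, q_reflects_comm.
    exists t0; apply q_t.
  - apply (A_class act co o fl t1 H); auto.
  - apply (central_not_embeds act co o fl t1 H G0 z0); auto.
    + intros m; apply (cover_has_section fl G0 q); auto using q_hom, q_onto.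
    (* [zF] moves the midpoint 3/4 of its support, so [z0] is nontrivial. *)
    + intros e; apply (f_equal (fun a => ev0 a (3/4))) in e.
      change (zF (3/4) = 3/4) in e; revert e; unfold zF; bump_tac.
    + intros b; apply q_reflects_comm; rewrite !q_hom, q_z, gone_l, gone_r; auto.
  - apply (cover_not_embeds act co o fl t1 H G0 q);
      auto using q_hom, q_onto, q_reflects_comm.
Qed.
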